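(* Let $Y\in M_s(\mathbb{C})^g$ be a semisimple point. Then $\mathcal{O}^{\mathrm{ua}}_Y$ contains a subalgebra isomorphic to $\mathcal{S}(Y)$. Hence if $\mathcal{S}(Y)=M_s(\mathbb{C})$, then $\mathcal{O}^{\mathrm{ua}}_Y\cong M_s(\mathcal{A})$ for some algebra $\mathcal{A}$. In particular, if a semisimple point $Y$ is not similar to a direct sum of scalar points (points of $\mathbb{C}^g$), then there exist uniformly analytic nc functions $f$ about $Y$ (i.e. elements $f\in\mathcal{O}^{\mathrm{ua}}_Y$) such that $f\neq0$ and $f^2=0$.
   Context: Let $\mathbb{C}^g_{\rm nc}=\bigsqcup_{n\in\mathbb{N}}M_n(\mathbb{C})^g$; direct sums and conjugations of tuples are taken componentwise, and $\oplus^nY$ is the direct sum of $n$ copies of $Y$. A point $Y\in M_s(\mathbb{C})^g$ is semisimple if every subspace of $\mathbb{C}^s$ invariant under $Y_1,\dots,Y_g$ admits a complementary subspace invariant under $Y_1,\dots,Y_g$. $\mathcal{S}(Y)$ is the unital $\mathbb{C}$-subalgebra of $M_s(\mathbb{C})$ generated by $Y_1,\dots,Y_g$. Points $Y,Y'\in M_s(\mathbb{C})^g$ are similar if $Y'=PYP^{-1}$ for some $P\in GL_s(\mathbb{C})$. A subset $\Omega\subseteq\mathbb{C}^g_{\rm nc}$ is an nc set if it is closed under direct sums; $\Omega_n=\Omega\cap M_n(\mathbb{C})^g$. An nc function $f:\Omega\to\bigsqcup_n M_n(\mathbb{C})$ satisfies $f(\Omega_n)\subseteq M_n(\mathbb{C})$,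 $f(X\oplus X')=f(X)\oplus f(X')$, and $f(SXS^{-1})=Sf(X)S^{-1}$ whenever $X,SXS^{-1}\in\Omega_n$, $S\in GL_n(\mathbb{C})$. For $X\in M_n(\mathbb{C})^g$ let $\|X\|$ be the maximum of the operator norms of its components. The uniformly open topology on $\mathbb{C}^g_{\rm nc}$ has as basis the nc balls $\mathbb{B}_\varepsilon(Y)=\bigsqcup_n\{X\in M_{ns}(\mathbb{C})^g:\|X-\oplus^nY\|<\varepsilon\}$, for $s\in\mathbb{N}$, $Y\in M_s(\mathbb{C})^g$, $\varepsilon>0$. An nc function on a uniformly open nc set is uniformly analytic if every point of its domain is the center of an nc ball on which $f$ is bounded. $\mathcal{O}^{\mathrm{ua}}_Y$ is the $\mathbb{C}$-algebra of equivalence classes of uniformly analytic nc functions defined on uniformly open nc neighborhoods of $Y$, where two functions are equivalent if they agree on some uniformly open nc neighborhood of $Y$. *)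

(* Defs.v *)
From HB Require Import structures.
From mathcomp Require Import all_boot all_order all_algebra all_field.
From mathcomp Require Import generic_quotient.
From mathcomp Require Import complex.
From mathcomp Require Import ring.
From mathcomp Require Import mathcomp_extra boolp classical_sets reals.

Set Implicit Arguments.
Unset Strict Implicit.
Unset Printing Implicit Defensive.
Import Order.TTheory GRing.Theory Num.Theory.
Local Open Scope classical_set_scope.
Local Open Scope ring_scope.
Local Open Scope quotient_scope.

Section OperatorNorm.
Variable R : realType.
Local Notation C := R[i].

Definition l2norm n (v : 'cV[C]_n) : R :=
  Num.sqrt (\sum_i Normc.normc (v i 0) ^+ 2).

Definition opnorm n (A : 'M[C]_n) : R :=
  sup [set l2norm (A *m v) | v in [set v | l2norm v <= 1]].

Lemma sum_normc_ge0 n (v : 'cV[C]_n) : 0 <= \sum_i Normc.normc (v i 0) ^+ 2.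
Proof. by apply: sumr_ge0 => i _; rewrite sqr_ge0. Qed.

Lemma normc_ge0 (z : C) : 0 <= Normc.normc z.
Proof. by case: z => a b; rewrite sqrtr_ge0. Qed.

Lemma l2norm_ge0 n (v : 'cV[C]_n) : 0 <= l2norm v.
Proof. exact: sqrtr_ge0. Qed.

Lemma l2norm_sqr n (v : 'cV[C]_n) :
  l2norm v ^+ 2 = \sum_i Normc.normc (v i 0) ^+ 2.
Proof. by rewrite sqr_sqrtr // sum_normc_ge0. Qed.

Lemma l2norm0 n : l2norm (0 : 'cV[C]_n) = 0.
Proof.
rewrite /l2norm big1 ?sqrtr0 // => i _; by rewrite mxE Normc.normc0 expr0n.
Qed.

Lemma l2norm_eq0 n (v : 'cV[C]_n) : l2norm v = 0 -> v = 0.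
Proof.
move=> v0; have /eqP := l2norm_sqr v; rewrite v0 expr0n eq_sym /=.
rewrite psumr_eq0 => [/allP vP|i _]; last exact: sqr_ge0.
apply/colP => i; rewrite mxE; apply: Normc.eq0_normc; apply/eqP.
by have := vP i; rewrite mem_index_enum sqrf_eq0 => /(_ isT).
Qed.

Lemma l2normZ n (c : C) (v : 'cV[C]_n) :
  l2norm (c *: v) = Normc.normc c * l2norm v.
Proof.
rewrite /l2norm -[X in X * _]ger0_norm ?normc_ge0 // -sqrtr_sqr.
rewrite -sqrtrM ?sqr_ge0 // mulr_sumr; congr Num.sqrt.
by apply: eq_bigr => i _; rewrite mxE Normc.normcM exprMn.
Qed.

Lemma cauchy_schwarz n (a b : 'I_n -> R) (A B : R) : 0 <= A -> 0 <= B ->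
  A ^+ 2 = \sum_i a i ^+ 2 -> B ^+ 2 = \sum_i b i ^+ 2 ->
  \sum_i a i * b i <= A * B.
Proof.
move=> A0 B0 EA EB.
have [A1|A1] := eqVneq A 0.
  rewrite A1 mul0r big1 // => i _.
  have /eqP := EA; rewrite A1 expr0n eq_sym psumr_eq0 => [/allP /(_ i)|? _].
    by rewrite mem_index_enum sqrf_eq0 => /(_ isT)/eqP ->; rewrite mul0r.
  exact: sqr_ge0.
have [B1|B1] := eqVneq B 0.
  rewrite B1 mulr0 big1 // => i _.
  have /eqP := EB; rewrite B1 expr0n eq_sym psumr_eq0 => [/allP /(_ i)|? _].
    by rewrite mem_index_enum sqrf_eq0 => /(_ isT)/eqP ->; rewrite mulr0.
  exact: sqr_ge0.
have AB0 : 0 < A * B by rewrite mulr_gt0 // lt_neqAle eq_sym ?A1 ?B1.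
rewrite -(ler_pM2l AB0) -(@ler_pM2l _ 2) //.
have -> : 2 * (A * B * (A * B)) =
    \sum_i (B ^+ 2 * a i ^+ 2 + A ^+ 2 * b i ^+ 2).
  rewrite big_split /= -!mulr_sumr -EA -EB (mulrC (B ^+ 2)) -mulr2n mulr_natl.
  by rewrite -expr2 exprMn.
rewrite !mulr_sumr; apply: ler_sum => i _.
rewrite -subr_ge0; have -> : B ^+ 2 * a i ^+ 2 + A ^+ 2 * b i ^+ 2
   - 2 * (A * B * (a i * b i)) = (B * a i - A * b i) ^+ 2.
  by ring.
exact: sqr_ge0.
Qed.

Lemma l2normD n (u v : 'cV[C]_n) : l2norm (u + v) <= l2norm u + l2norm v.
Proof.
have uv0 : 0 <= l2norm u + l2norm v by rewrite addr_ge0 ?l2norm_ge0.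
rewrite -(ler_pXn2r (n := 2)) ?nnegrE ?l2norm_ge0 //.
rewrite sqrrD !l2norm_sqr.
apply: (@le_trans _ _ (\sum_i (Normc.normc (u i 0) ^+ 2 +
    (Normc.normc (u i 0) * Normc.normc (v i 0)) *+ 2
    + Normc.normc (v i 0) ^+ 2))).
  apply: ler_sum => i _; rewrite -sqrrD ler_pXn2r ?nnegrE ?addr_ge0 ?normc_ge0 //.
  by rewrite mxE; exact: le_normcD.
rewrite !big_split /= lerD2r lerD2l.
rewrite -mulr2n lerMn2r /=; apply: cauchy_schwarz;
  rewrite ?l2norm_ge0 ?l2norm_sqr //.
Qed.

Lemma l2norm_sum n m (F : 'I_m -> 'cV[C]_n) :
  l2norm (\sum_j F j) <= \sum_j l2norm (F j).
Proof.
elim/big_rec2: _ => [|j y x _ le_xy]; first by rewrite l2norm0.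
by apply: le_trans (l2normD _ _) _; rewrite lerD2l.
Qed.

Lemma normc_le_l2norm n (v : 'cV[C]_n) i : Normc.normc (v i 0) <= l2norm v.
Proof.
rewrite -(ler_pXn2r (n := 2)) ?nnegrE ?l2norm_ge0 ?normc_ge0 //.
by rewrite l2norm_sqr (bigD1 i) //= lerDl sumr_ge0 // => j _; exact: sqr_ge0.
Qed.

Lemma l2norm_bounded n (A : 'M[C]_n) :
  exists2 K : R, 0 <= K & forall v, l2norm (A *m v) <= K * l2norm v.
Proof.
exists (\sum_j l2norm (col j A)).
  by apply: sumr_ge0 => j _; exact: l2norm_ge0.
move=> v; have -> : A *m v = \sum_j v j 0 *: col j A.
  apply/colP => i; rewrite summxE mxE; apply: eq_bigr => j _.
  by rewrite !mxE mulrC.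
apply: le_trans (l2norm_sum _) _; rewrite mulr_suml.
apply: ler_sum => j _; rewrite l2normZ mulrC.
by rewrite ler_wpM2l ?l2norm_ge0 ?normc_le_l2norm.
Qed.

Lemma opnorm_has_sup n (A : 'M[C]_n) :
  has_sup [set l2norm (A *m v) | v in [set v | l2norm v <= 1]].
Proof.
split; first by exists (l2norm (A *m 0)), 0; rewrite //= l2norm0.
have [K K0 KP] := l2norm_bounded A; exists K => _ [v v1 <-].
by apply: le_trans (KP v) _; rewrite ler_piMr.
Qed.

Lemma opnormP n (A : 'M[C]_n) (v : 'cV[C]_n) :
  l2norm (A *m v) <= opnorm A * l2norm v.
Proof.
have [v0|v0] := eqVneq (l2norm v) 0.
  by rewrite (l2norm_eq0 v0) mulmx0 l2norm0 mulr0.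
have vp : 0 < l2norm v by rewrite lt_neqAle eq_sym v0 l2norm_ge0.
pose w := ((l2norm v)^-1)%:C%C *: v.
have nz : Normc.normc ((l2norm v)^-1)%:C%C = (l2norm v)^-1.
  rewrite /Normc.normc /= expr0n addr0 sqrtr_sqr ger0_norm //.
  by rewrite invr_ge0 l2norm_ge0.
have w1 : l2norm w = 1 by rewrite l2normZ nz mulVf.
rewrite -ler_pdivrMr // mulrC -nz -l2normZ scalemxAr.
apply: (sup_upper_bound (opnorm_has_sup A)).
by exists w; rewrite //= w1.
Qed.

Lemma opnorm_le n (A : 'M[C]_n) (c : R) : 0 <= c ->
  (forall v, l2norm (A *m v) <= c * l2norm v) -> opnorm A <= c.
Proof.
move=> c0 cP; apply: ge_sup; first by case: (opnorm_has_sup A).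
by move=> _ [v v1 <-]; apply: le_trans (cP v) _; rewrite ler_piMr.
Qed.

Lemma opnorm_ge0 n (A : 'M[C]_n) : 0 <= opnorm A.
Proof.
apply: (sup_upper_bound (opnorm_has_sup A)).
by exists 0; rewrite /= ?mulmx0 l2norm0.
Qed.

Lemma opnorm0 n : opnorm (0 : 'M[C]_n) = 0.
Proof.
apply/eqP; rewrite eq_le opnorm_ge0 andbT; apply: opnorm_le => // v.
by rewrite mul0mx l2norm0 mul0r.
Qed.

Lemma opnormD n (A B : 'M[C]_n) : opnorm (A + B) <= opnorm A + opnorm B.
Proof.
apply: opnorm_le; first by rewrite addr_ge0 ?opnorm_ge0.
move=> v; rewrite mulmxDl mulrDl; apply: le_trans (l2normD _ _) _.
by rewrite lerD ?opnormP.
Qed.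

Lemma opnormM n (A B : 'M[C]_n) : opnorm (A *m B) <= opnorm A * opnorm B.
Proof.
apply: opnorm_le; first by rewrite mulr_ge0 ?opnorm_ge0.
move=> v; rewrite -mulmxA -mulrA; apply: le_trans (opnormP _ _) _.
by rewrite ler_wpM2l ?opnorm_ge0 ?opnormP.
Qed.

Lemma opnorm_scalar n (c : C) : opnorm (c%:M : 'M[C]_n) <= Normc.normc c.
Proof.
apply: opnorm_le; first exact: normc_ge0.
by move=> v; rewrite mul_scalar_mx l2normZ.
Qed.

Lemma l2norm_col m n (u : 'cV[C]_m) (v : 'cV[C]_n) :
  l2norm (col_mx u v) ^+ 2 = l2norm u ^+ 2 + l2norm v ^+ 2.
Proof.
rewrite !l2norm_sqr big_split_ord /=; congr (_ + _); apply: eq_bigr => i _.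
  by rewrite col_mxEu.
by rewrite col_mxEd.
Qed.

Lemma opnorm_block m n (A : 'M[C]_m) (B : 'M[C]_n) (c : R) :
  opnorm A <= c -> opnorm B <= c -> opnorm (block_mx A 0 0 B) <= c.
Proof.
move=> Ac Bc; have c0 : 0 <= c by apply: le_trans Ac; exact: opnorm_ge0.
apply: opnorm_le => // v; rewrite -[v]vsubmxK mul_block_col !mul0mx addr0 add0r.
rewrite -(ler_pXn2r (n := 2)) ?nnegrE ?mulr_ge0 ?l2norm_ge0 //.
rewrite exprMn !l2norm_col mulrDr -!exprMn.
by apply: lerD; rewrite ler_pXn2r ?nnegrE ?mulr_ge0 ?l2norm_ge0 //;
  apply: le_trans (opnormP _ _) _; rewrite ler_wpM2r ?l2norm_ge0.
Qed.

Lemma opnorm_cast m n (E : m = n) (A : 'M[C]_m) :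
  opnorm (castmx (E, E) A) = opnorm A.
Proof. by case: n / E; rewrite castmx_id. Qed.

End OperatorNorm.

Section NcSpace.
Variables (R : realType) (g : nat).
Local Notation C := R[i].

Definition ncpt (n : nat) := 'I_g -> 'M[C]_n.

Definition ptdsum m n (X : ncpt m) (X' : ncpt n) : ncpt (m + n) :=
  fun i => block_mx (X i) 0 0 (X' i).

Definition ptconj n (S : 'M[C]_n) (X : ncpt n) : ncpt n :=
  fun i => S *m X i *m invmx S.

Fixpoint ptampl s (m : nat) (Y : ncpt s) : ncpt (m * s) :=
  if m is m'.+1 then ptdsum Y (ptampl m' Y) else fun=> 0.

Definition ptnorm n (X : ncpt n) : R := \big[Num.max/0]_(i < g) opnorm (X i).

(* A subset of the nc space is given by its levels.  The nc space has only
   positive levels; here level 0 is left in the type [ncfam] but nc balls,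
   hence uniformly open sets, do not meet it. *)
Definition ncfam := forall n : nat, set (ncpt n).

Definition ncsub (U V : ncfam) := forall n, U n `<=` V n.

Definition ncsetP (U : ncfam) :=
  forall m n (X : ncpt m) (X' : ncpt n),
    U m X -> U n X' -> U (m + n)%N (ptdsum X X').

Definition ncball s (Y : ncpt s) (e : R) : ncfam := fun n X =>
  exists (m : nat) (E : n = (m * s)%N), (0 < m)%N /\
    ptnorm (fun i => castmx (E, E) (X i) - ptampl m Y i) < e.

Definition uopen (U : ncfam) :=
  forall n (X : ncpt n), U n X ->
    exists (s : nat) (Y : ncpt s) (e : R),
      [/\ (0 < s)%N, 0 < e, ncball Y e X & ncsub (ncball Y e) U].

(* Only the values on the domain under consideration matter. *)
Definition ncmap := forall n : nat, ncpt n -> 'M[C]_n.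

Definition ncfun (U : ncfam) (f : ncmap) :=
  (forall m n (X : ncpt m) (X' : ncpt n), U m X -> U n X' ->
     f _ (ptdsum X X') = block_mx (f _ X) 0 0 (f _ X')) /\
  (forall n (X : ncpt n) (S : 'M[C]_n), S \in unitmx -> U n X ->
     U n (ptconj S X) -> f _ (ptconj S X) = S *m f _ X *m invmx S).

Definition uanalytic (U : ncfam) (f : ncmap) :=
  forall n (X : ncpt n), U n X ->
    exists e : R, [/\ 0 < e, ncsub (ncball X e) U &
      exists c : R, forall m (Z : ncpt m), ncball X e Z -> opnorm (f _ Z) <= c].

Lemma ptnorm_lt n (X : ncpt n) (c : R) : 0 < c ->
  (forall i, opnorm (X i) < c) -> ptnorm X < c.
Proof. by move=> c0 H; apply: bigmax_lt. Qed.

Lemma ptnorm_le n (X : ncpt n) (c : R) : 0 <= c ->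
  (forall i, opnorm (X i) <= c) -> ptnorm X <= c.
Proof. by move=> c0 H; apply: bigmax_le. Qed.

Lemma ptnorm_ge n (X : ncpt n) i : opnorm (X i) <= ptnorm X.
Proof. exact: (le_bigmax _ (fun i => opnorm (X i))). Qed.

Lemma ptnorm_ge0 n (X : ncpt n) : 0 <= ptnorm X.
Proof. exact: bigmax_ge_id. Qed.

Lemma ptampl_entry s m (Y : ncpt s) i (a b : 'I_(m * s)) (a' b' : 'I_s)
    (qa qb : nat) :
  a = (qa * s + a')%N :> nat -> b = (qb * s + b')%N :> nat ->
  ptampl m Y i a b = if qa == qb then Y i a' b' else 0.
Proof.
have quot (q r : nat) : (r < s -> (q.+1 * s + r < s) = false)%N.
  by move=> _; rewrite mulSn -addnA ltnNge leq_addr.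
elim: m a b qa qb => [|m IHm] a b qa qb Ea Eb; first by case: a Ea.
rewrite /= /ptdsum mxE; case: splitP => [a1|a1] Ea1; rewrite mxE;
  case: splitP => [b1|b1] Eb1.
- have qa0 : qa = 0%N.
    by case: qa Ea => // q Ea; have := quot q a' (ltn_ord a');
      rewrite -Ea Ea1 ltn_ord.
  have qb0 : qb = 0%N.
    by case: qb Eb => // q Eb; have := quot q b' (ltn_ord b');
      rewrite -Eb Eb1 ltn_ord.
  subst qa qb; congr (Y i _ _); apply: val_inj => /=.
    by rewrite -Ea1 Ea.
  by rewrite -Eb1 Eb.
- have qa0 : qa = 0%N.
    by case: qa Ea => // q Ea; have := quot q a' (ltn_ord a');
      rewrite -Ea Ea1 ltn_ord.
  have qb0 : qb != 0%N.
    apply: contraTneq (ltn_ord b') => qb0; move: Eb; rewrite qb0 Eb1.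
    by rewrite mul0n add0n => <-; rewrite -leqNgt leq_addr.
  by rewrite mxE qa0 eq_sym (negPf qb0).
- have qb0 : qb = 0%N.
    by case: qb Eb => // q Eb; have := quot q b' (ltn_ord b');
      rewrite -Eb Eb1 ltn_ord.
  have qa0 : qa != 0%N.
    apply: contraTneq (ltn_ord a') => qa0; move: Ea; rewrite qa0 Ea1.
    by rewrite mul0n add0n => <-; rewrite -leqNgt leq_addr.
  by rewrite mxE qb0 (negPf qa0).
- case: qa Ea => [|qa] Ea.
    by move: (ltn_ord a'); move: Ea; rewrite Ea1 mul0n add0n => <-;
       rewrite ltnNge leq_addr.
  case: qb Eb => [|qb] Eb.
    by move: (ltn_ord b'); move: Eb; rewrite Eb1 mul0n add0n => <-;
       rewrite ltnNge leq_addr.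
  rewrite eqSS; apply: IHm; apply/eqP; rewrite -(eqn_add2l s).
    by rewrite -Ea1 Ea mulSn addnA.
  by rewrite -Eb1 Eb mulSn addnA.
Qed.

Lemma ptampl1 s (Y : ncpt s) (E : s = (1 * s)%N) i :
  castmx (E, E) (Y i) = ptampl 1 Y i.
Proof.
apply/matrixP => a b; rewrite castmxE.
by rewrite (@ptampl_entry _ _ _ _ _ _ (cast_ord (esym E) a)
   (cast_ord (esym E) b) 0%N 0%N).
Qed.

Lemma ptamplM s k m (Y : ncpt s) (E : (k * (m * s) = k * m * s)%N) i :
  castmx (E, E) (ptampl k (ptampl m Y) i) = ptampl (k * m) Y i.
Proof.
apply/matrixP => a b; rewrite castmxE /=.
have s0 : (0 < s)%N by move: (leq_trans (ltn0Sn _) (ltn_ord a));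
  rewrite muln_gt0 => /andP[].
have m0 : (0 < m)%N by move: (leq_trans (ltn0Sn _) (ltn_ord a));
  rewrite !muln_gt0 => /andP[/andP[]].
have ub (x : nat) : ((x %/ s) %% m * s + x %% s < m * s)%N.
  apply: (@leq_trans ((x %/ s) %% m * s + s)).
    by rewrite ltn_add2l ltn_pmod.
  by rewrite addnC -mulSn leq_mul2r ltn_pmod ?orbT.
have dec (x : nat) :
  x = (x %/ s %/ m * (m * s) + (x %/ s %% m * s + x %% s))%N.
  by rewrite addnA mulnA -mulnDl -divn_eq -divn_eq.
pose r (x : nat) : 'I_s := Ordinal (ltn_pmod x s0).
rewrite (@ptampl_entry s (k * m) Y i a b (r a) (r b) (a %/ s) (b %/ s))
  ?[LHS]divn_eq //; try exact: divn_eq.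
rewrite (@ptampl_entry (m * s) k _ i _ _ (Ordinal (ub a)) (Ordinal (ub b))
  (a %/ s %/ m) (b %/ s %/ m)); try exact: dec.
rewrite (@ptampl_entry s m Y i _ _ (r a) (r b) (a %/ s %% m) (b %/ s %% m)) //.
have [->|ne] := eqVneq (a %/ s)%N (b %/ s)%N; first by rewrite !eqxx.
have [eq1|//] := eqVneq; have [eq2|//] := eqVneq.
by case/eqP: ne; rewrite (divn_eq (a %/ s) m) (divn_eq (b %/ s) m) eq1 eq2.
Qed.

Lemma ptamplB s k (X Y : ncpt s) i :
  ptampl k X i - ptampl k Y i = ptampl k (fun i => X i - Y i) i.
Proof.
elim: k => [|k IHk] /=; first by rewrite subr0.
by rewrite /ptdsum opp_block_mx add_block_mx IHk !subr0.
Qed.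

Lemma opnorm_ptampl s k (X : ncpt s) i : opnorm (ptampl k X i) <= opnorm (X i).
Proof.
elim: k => [|k IHk] /=; first by rewrite opnorm0 opnorm_ge0.
exact: opnorm_block.
Qed.

Lemma ncball_center s (Y : ncpt s) e : 0 < e -> ncball Y e Y.
Proof.
move=> e0; exists 1%N, (esym (mul1n s)); split=> //.
by apply: ptnorm_lt => // i; rewrite ptampl1 subrr opnorm0.
Qed.

Lemma ncball_le s (Y : ncpt s) e e' : e <= e' -> ncsub (ncball Y e) (ncball Y e').
Proof.
by move=> ee n X [m [E [m0 lt]]]; exists m, E; split=> //; exact: lt_le_trans ee.
Qed.

Lemma ncball_sub s (Y : ncpt s) e n (X : ncpt n) : ncball Y e X ->
  exists2 d, 0 < d & ncsub (ncball X d) (ncball Y e).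
Proof.
case=> m [E [m0 lt]]; subst n.
pose D : ncpt (m * s) := fun i => X i - ptampl m Y i.
have De : ptnorm D < e.
  suff <- : ptnorm (fun i => castmx (erefl, erefl) (X i) - ptampl m Y i) =
    ptnorm D by [].
  by apply: eq_bigr => i _; rewrite castmx_id.
exists (e - ptnorm D); first by rewrite subr_gt0.
move=> n Z [k [F [k0 lt']]]; subst n.
have G : (k * (m * s) = k * m * s)%N by rewrite mulnA.
exists (k * m)%N, G; split; first by rewrite muln_gt0 k0.
apply: ptnorm_lt => [|i]; first by apply: le_lt_trans De; exact: ptnorm_ge0.
rewrite -(ptamplM Y G).
have -> : castmx (G, G) (Z i) - castmx (G, G) (ptampl k (ptampl m Y) i) =
    castmx (G, G) ((Z i - ptampl k X i) + ptampl k D i).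
  rewrite -ptamplB addrA subrK.
  by apply/matrixP => a b; rewrite !(castmxE, mxE).
rewrite opnorm_cast; apply: le_lt_trans (opnormD _ _) _.
rewrite -(subrK (ptnorm D) e); apply: ltr_leD; last first.
  by apply: le_trans (opnorm_ptampl _ _ _) _; exact: (ptnorm_ge D).
apply: le_lt_trans lt'.
have := ptnorm_ge (fun i => castmx (erefl, erefl) (Z i) - ptampl k X i) i.
by rewrite /= castmx_id.
Qed.

Lemma uopenP (U : ncfam) : uopen U -> forall n (X : ncpt n), U n X ->
  (0 < n)%N /\ exists2 d, 0 < d & ncsub (ncball X d) U.
Proof.
move=> Uo n X /Uo[s [Y [e [s0 e0 YX YU]]]]; split.
  by case: YX => m [E [m0 _]]; rewrite E muln_gt0 m0.
have [d d0 dP] := ncball_sub YX; exists d => // k Z /dP; exact: YU.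
Qed.

Lemma uopen_ball (U : ncfam) :
  (forall n (X : ncpt n), U n X ->
    (0 < n)%N /\ exists2 d, 0 < d & ncsub (ncball X d) U) -> uopen U.
Proof.
move=> H n X /H[n0 [d d0 dU]]; exists n, X, d; split=> //.
exact: ncball_center.
Qed.

Definition nccap (U V : ncfam) : ncfam := fun n => U n `&` V n.

Lemma uopen_cap U V : uopen U -> uopen V -> uopen (nccap U V).
Proof.
move=> /uopenP Uo /uopenP Vo; apply: uopen_ball => n X [/Uo[n0 [d d0 dU]]].
move=> /Vo[_ [d' d'0 dV]]; split=> //; exists (Num.min d d').
  by rewrite lt_min d0.
move=> k Z Zd; split.
  by apply: dU; apply: ncball_le Zd; rewrite ge_min lexx.
by apply: dV; apply: ncball_le Zd; rewrite ge_min lexx orbT.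
Qed.

Lemma ncsetP_cap U V : ncsetP U -> ncsetP V -> ncsetP (nccap U V).
Proof. by move=> HU HV m n X X' [? ?] [? ?]; split; [apply: HU|apply: HV]. Qed.

End NcSpace.

Arguments ncfam : clear implicits.
Arguments ncmap : clear implicits.

Section Germs.
Variables (R : realType) (g s : nat) (Y : ncpt R g s.+1).
Local Notation C := R[i].

Definition ncnbhd (U : ncfam R g) := [/\ uopen U, ncsetP U & U _ Y].

Record uarep := UARep {
  udom : ncfam R g;
  ufun : ncmap R g;
  udomP : ncnbhd udom;
  ufun_nc : ncfun udom ufun;
  ufun_ua : uanalytic udom ufun }.

HB.instance Definition _ := gen_eqMixin uarep.
HB.instance Definition _ := gen_choiceMixin uarep.

Definition uarep_equiv (f h : uarep) : Prop :=
  exists W, [/\ ncnbhd W, ncsub W (udom f), ncsub W (udom h) &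
    forall n (X : ncpt R g n), W n X -> ufun f X = ufun h X].

Lemma ncnbhd_cap U V : ncnbhd U -> ncnbhd V -> ncnbhd (nccap U V).
Proof.
by case=> ? ? ? [? ? ?]; split; [exact: uopen_cap|exact: ncsetP_cap|].
Qed.

Lemma uarep_equiv_cap (f h : uarep) :
  (forall n (X : ncpt R g n), udom f X -> udom h X -> ufun f X = ufun h X) ->
  uarep_equiv f h.
Proof.
move=> fh; exists (nccap (udom f) (udom h)); split.
- by apply: ncnbhd_cap; exact: udomP.
- by move=> n X [].
- by move=> n X [].
- by move=> n X [fX hX]; exact: fh.
Qed.

Definition uarep_equivb (f h : uarep) : bool := `[< uarep_equiv f h >].

Lemma uarep_equivb_refl : reflexive uarep_equivb.
Proof. by move=> f; apply/asboolP; apply: uarep_equiv_cap. Qed.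

Lemma uarep_equivb_sym : symmetric uarep_equivb.
Proof.
by move=> f h; apply/asboolP/asboolP => -[W [? ? ? E]]; exists W; split=> // n X /E.
Qed.

Lemma uarep_equivb_trans : transitive uarep_equivb.
Proof.
move=> h f k /asboolP[W [Wn Wf Wh E]] /asboolP[V [Vn Vh Vk E']].
apply/asboolP; exists (nccap W V); split; first exact: ncnbhd_cap.
- by move=> n X [/Wf].
- by move=> n X [_ /Vk].
- by move=> n X [WX VX]; rewrite E // E'.
Qed.

Canonical uarep_equivb_equiv := EquivRel uarep_equivb
  uarep_equivb_refl uarep_equivb_sym uarep_equivb_trans.

Definition Oua := {eq_quot uarep_equivb}.
HB.instance Definition _ := Choice.on Oua.
HB.instance Definition _ := EqQuotient.on Oua.

Lemma OuaP (f h : uarep) :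
  reflect (uarep_equiv f h) (\pi_Oua f == \pi_Oua h).
Proof. by rewrite piE; exact: asboolP. Qed.

Definition ncpos : ncfam R g := fun n _ => (0 < n)%N.

Lemma ncball_pos n (X : ncpt R g n) e : (0 < n)%N -> ncsub (ncball X e) ncpos.
Proof. by move=> n0 k Z [m [E [m0 _]]]; rewrite /ncpos E muln_gt0 m0. Qed.

Lemma ncpos_nbhd : ncnbhd ncpos.
Proof.
split=> //; first apply: uopen_ball => n X n0.
  by split=> //; exists 1 => //; exact: ncball_pos.
by move=> m n X X' m0 _; rewrite /ncpos addn_gt0 [(0 < m)%N]m0.
Qed.

Lemma const_nc (c : C) : ncfun ncpos (fun n _ => c%:M).
Proof.
split=> [m n X X' _ _|n X S uS _ _]; first exact: scalar_mx_block.
by rewrite scalar_mxC -mulmxA mulmxV // mulmx1.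
Qed.

Lemma const_ua (c : C) : uanalytic ncpos (fun n _ => c%:M).
Proof.
move=> n X n0; exists 1; split=> //; first exact: ncball_pos.
by exists (Normc.normc c) => m Z _; exact: opnorm_scalar.
Qed.

Definition uaconst (c : C) : uarep :=
  UARep ncpos_nbhd (const_nc c) (const_ua c).

Lemma ua_bound2 (f h : uarep) n (X : ncpt R g n) :
  nccap (udom f) (udom h) X ->
  exists e : R, [/\ 0 < e, ncsub (ncball X e) (nccap (udom f) (udom h)) &
    exists c d : R, forall m (Z : ncpt R g m), ncball X e Z ->
      opnorm (ufun f Z) <= c /\ opnorm (ufun h Z) <= d].
Proof.
case=> /ufun_ua[e [e0 eU [c cP]]] /ufun_ua[d [d0 dU [k kP]]].
have le1 : Num.min e d <= e by rewrite ge_min lexx.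
have le2 : Num.min e d <= d by rewrite ge_min lexx orbT.
exists (Num.min e d); split; first by rewrite lt_min e0.
  by move=> m Z Zb; split; [apply: eU|apply: dU]; apply: ncball_le Zb.
by exists c, k => m Z Zb; split; [apply: cP|apply: kP]; apply: ncball_le Zb.
Qed.

Section Operations.
Variables f h : uarep.
Let D := nccap (udom f) (udom h).

Fact ua_capP : ncnbhd D.
Proof. by apply: ncnbhd_cap; exact: udomP. Qed.

Fact uaadd_nc : ncfun D (fun n X => ufun f X + ufun h X).
Proof.
case: (ufun_nc f) (ufun_nc h) => [fd fs] [hd hs]; split.
  move=> m n X X' [fX hX] [fX' hX']; rewrite fd // hd //.
  by rewrite add_block_mx !addr0.
move=> n X S uS [fX hX] [fX' hX']; rewrite fs // hs //.
by rewrite mulmxDr mulmxDl.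
Qed.

Fact uaadd_ua : uanalytic D (fun n X => ufun f X + ufun h X).
Proof.
move=> n X /ua_bound2[e [e0 eD [c [d cd]]]]; exists e; split=> //.
exists (c + d) => m Z /cd[cZ dZ]; apply: le_trans (opnormD _ _) _.
exact: lerD.
Qed.

Definition uaadd := UARep ua_capP uaadd_nc uaadd_ua.

Fact uamul_nc : ncfun D (fun n X => ufun f X *m ufun h X).
Proof.
case: (ufun_nc f) (ufun_nc h) => [fd fs] [hd hs]; split.
  move=> m n X X' [fX hX] [fX' hX']; rewrite fd // hd //.
  by rewrite mulmx_block !mulmx0 !mul0mx !addr0 add0r.
move=> n X S uS [fX hX] [fX' hX']; rewrite fs // hs //.
by rewrite !mulmxA mulmxKV.
Qed.

Fact uamul_ua : uanalytic D (fun n X => ufun f X *m ufun h X).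
Proof.
move=> n X /ua_bound2[e [e0 eD [c [d cd]]]]; exists e; split=> //.
exists (c * d) => m Z /cd[cZ dZ]; apply: le_trans (opnormM _ _) _.
by apply: ler_pM; rewrite ?opnorm_ge0.
Qed.

Definition uamul := UARep ua_capP uamul_nc uamul_ua.

End Operations.

Definition uascale (c : C) (f : uarep) := uamul (uaconst c) f.

Lemma uaadd_compat f f' h h' :
  uarep_equiv f f' -> uarep_equiv h h' -> uarep_equiv (uaadd f h) (uaadd f' h').
Proof.
move=> [W [Wn Wf Wf' E]] [V [Vn Vh Vh' E']]; exists (nccap W V); split.
- exact: ncnbhd_cap.
- by move=> n X [WX VX]; split; [apply: Wf|apply: Vh].
- by move=> n X [WX VX]; split; [apply: Wf'|apply: Vh'].
- by move=> n X [WX VX] /=; rewrite E // E'.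
Qed.

Lemma uamul_compat f f' h h' :
  uarep_equiv f f' -> uarep_equiv h h' -> uarep_equiv (uamul f h) (uamul f' h').
Proof.
move=> [W [Wn Wf Wf' E]] [V [Vn Vh Vh' E']]; exists (nccap W V); split.
- exact: ncnbhd_cap.
- by move=> n X [WX VX]; split; [apply: Wf|apply: Vh].
- by move=> n X [WX VX]; split; [apply: Wf'|apply: Vh'].
- by move=> n X [WX VX] /=; rewrite E // E'.
Qed.

Lemma uarep_equiv_refl f : uarep_equiv f f.
Proof. exact: uarep_equiv_cap. Qed.

Lemma repr_piK f : uarep_equiv (repr (\pi_Oua f)) f.
Proof. by apply/OuaP; rewrite reprK. Qed.

Definition oconst (c : C) : Oua := lift_cst Oua (uaconst c).
Canonical pi_oconst_morph c := PiConst (oconst c).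

Definition oadd := lift_op2 Oua uaadd.
Lemma pi_oadd : {morph \pi : f h / uaadd f h >-> oadd f h}.
Proof.
move=> f h; unlock oadd; apply/eqP/OuaP; apply: uaadd_compat;
  by apply/OuaP; rewrite reprK.
Qed.
Canonical pi_oadd_morph := PiMorph2 pi_oadd.

Definition omul := lift_op2 Oua uamul.
Lemma pi_omul : {morph \pi : f h / uamul f h >-> omul f h}.
Proof.
move=> f h; unlock omul; apply/eqP/OuaP; apply: uamul_compat;
  by apply/OuaP; rewrite reprK.
Qed.
Canonical pi_omul_morph := PiMorph2 pi_omul.

Definition oopp (x : Oua) := omul (oconst (-1)) x.
Definition oscale (c : C) (x : Oua) := omul (oconst c) x.

Local Ltac by_reps :=
  rewrite /oopp /oscale !piE; apply/eqP/OuaP; apply: uarep_equiv_cap => n X _ _ /=.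

Fact oaddA : associative oadd.
Proof.
by elim/quotW => x; elim/quotW => y; elim/quotW => z; by_reps; rewrite addrA.
Qed.

Fact oaddC : commutative oadd.
Proof. by elim/quotW => x; elim/quotW => y; by_reps; rewrite addrC. Qed.

Fact oadd0 : left_id (oconst 0) oadd.
Proof. by elim/quotW => x; by_reps; rewrite raddf0 add0r. Qed.

Fact oaddN : left_inverse (oconst 0) oopp oadd.
Proof.
by elim/quotW => x; by_reps; rewrite mul_scalar_mx scaleN1r addNr raddf0.
Qed.

HB.instance Definition _ := GRing.isZmodule.Build Oua oaddA oaddC oadd0 oaddN.

Fact omulA : associative omul.
Proof.
by elim/quotW => x; elim/quotW => y; elim/quotW => z; by_reps; rewrite mulmxA.
Qed.

Fact omul1l : left_id (oconst 1) omul.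
Proof. by elim/quotW => x; by_reps; rewrite mul1mx. Qed.

Fact omul1r : right_id (oconst 1) omul.
Proof. by elim/quotW => x; by_reps; rewrite mulmx1. Qed.

Fact omulDl : left_distributive omul oadd.
Proof.
by elim/quotW => x; elim/quotW => y; elim/quotW => z; by_reps; rewrite mulmxDl.
Qed.

Fact omulDr : right_distributive omul oadd.
Proof.
by elim/quotW => x; elim/quotW => y; elim/quotW => z; by_reps; rewrite mulmxDr.
Qed.

Fact oconst1_neq0 : oconst 1 != oconst 0.
Proof.
rewrite !piE; apply/asboolP => -[W [[_ _ WY] _ _ /(_ _ _ WY)]] /= /matrixP.
by move=> /(_ 0 0)/eqP; rewrite !mxE eqxx mulr1n mul0rn oner_eq0.
Qed.

HB.instance Definition _ := GRing.Zmodule_isNzRing.Build Oua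
  omulA omul1l omul1r omulDl omulDr oconst1_neq0.

Fact oscaleA a b x : oscale a (oscale b x) = oscale (a * b) x.
Proof.
by elim/quotW: x => x; by_reps; rewrite !mul_scalar_mx scalerA.
Qed.

Fact oscale1 : left_id 1 oscale.
Proof. exact: omul1l. Qed.

Fact oscaleDr : right_distributive oscale +%R.
Proof. move=> a x y; exact: omulDr. Qed.

Fact oscaleDl x : {morph oscale^~ x : a b / a + b}.
Proof.
move=> a b; rewrite -[RHS]/(oadd (oscale a x) (oscale b x)).
elim/quotW: x => x; by_reps.
by rewrite !mul_scalar_mx scalerDl.
Qed.

HB.instance Definition _ := GRing.Zmodule_isLmodule.Build C Oua
  oscaleA oscale1 oscaleDr oscaleDl.

Fact oscaleAl a (x y : Oua) : a *: (x * y) = (a *: x) * y.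
Proof. exact: omulA. Qed.

HB.instance Definition _ := GRing.Lmodule_isLalgebra.Build C Oua oscaleAl.

Fact oscaleAr a (x y : Oua) : a *: (x * y) = x * (a *: y).
Proof.
rewrite -[LHS]/(oscale a (omul x y)) -[RHS]/(omul x (oscale a y)).
elim/quotW: x => x; elim/quotW: y => y; by_reps.
by rewrite !mul_scalar_mx scalemxAr.
Qed.

HB.instance Definition _ := GRing.Lalgebra_isAlgebra.Build C Oua oscaleAr.

End Germs.

Section SemisimplePoints.
Variables (R : realType) (g s : nat) (Y : ncpt R g s.+1).
Local Notation C := R[i].

Definition invariant_subspace (U : {vspace 'cV[C]_s.+1}) :=
  forall i v, v \in U -> Y i *m v \in U.

Definition semisimple_pt :=
  forall U : {vspace 'cV[C]_s.+1}, invariant_subspace U ->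
    exists W : {vspace 'cV[C]_s.+1},
      [/\ invariant_subspace W, (U + W = fullv)%VS & (U :&: W = 0)%VS].

(* [agenv] always contains 1. *)
Definition pt_alg : {aspace 'M[C]_s.+1} := <<<<codom Y>>>>%AS.

Definition pt_similar (Y' : ncpt R g s.+1) :=
  exists2 P : 'M[C]_s.+1, P \in unitmx & Y' = ptconj P Y.

(* The direct sum of the scalar points lam 0, ..., lam s of C^g. *)
Definition scalar_dsum (lam : 'I_s.+1 -> 'I_g -> C) : ncpt R g s.+1 :=
  fun i => diag_mx (\row_j lam j i).

End SemisimplePoints.

(* Main.v *)
Require Import Defs.
From HB Require Import structures.
From mathcomp Require Import all_boot all_order all_algebra all_field.
From mathcomp Require Import generic_quotient.
From mathcomp Require Import complex ring lra.
From mathcomp Require Import boolp classical_sets reals.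
Set Implicit Arguments.
Unset Strict Implicit.
Unset Printing Implicit Defensive.
Import Order.TTheory GRing.Theory Num.Theory.
Local Open Scope ring_scope.

(** Let A be the algebra generated by the components of a semisimple point Y.
    Since C^s is a semisimple faithful A-module, A has no nonzero nil ideal,
    hence in characteristic 0 its regular trace form is nondegenerate
    ([pt_regtr_nondeg]).  Dual bases x, y for that form make the tensor
    sum x_i (x) y_i a separability idempotent of A
    ([separability_idempotent]).

    Choosing noncommutative polynomials that take at Y the values of a basis
    of A gives, for every point X, a linear unital map A -> M_n(C), natural in
    X.  At an amplification of Y it is multiplicative, so near one it is almost
    multiplicative, with a defect bounded uniformly in the level n
    ([polylift_near]).  Separability says that the second Hochschild cohomology
    of A vanishes through an explicit contracting homotopy.  Correcting a
    unital linear map by the image of its defect under that homotopy squares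
    the size of the defect ([newton_defect], [newton_defect_bound]), so
    iterating converges to a genuine homomorphism A -> M_n(C) whose norm is
    bounded independently of X and n.

    Each iterate is built from the previous one by the ring operations alone;
    therefore it commutes with every matrix intertwining two points, and so
    does the limit ([newton_lim_intertwine]).  Compatibility with direct sums
    and with similarities are two cases of this.  The limit is thus an algebra
    homomorphism from A to the uniformly analytic germs at Y; evaluating at Y,
    where nothing needs to be corrected, returns the inclusion of A into
    M_s(C), so it is injective ([semisimple_embedding]).

    If A = M_s(C), the images of the elementary matrices are matrix units in
    the algebra of germs, which is then a full matrix algebra over their
    centralizer ([matrix_units_iso]).  If A has no nonzero element of square
    zero, then each of its elements is diagonalizable and any two commute
    ([reduced_diagonalizable], [reduced_comm]), so Y is similar to a direct sum
    of scalar points.  Otherwise an element of square zero in A gives a germ of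
    square zero. *)

(** * Separability of an algebra with nondegenerate regular trace *)

Lemma mxtrace_idem (F : fieldType) n (P : 'M[F]_n) :
  P *m P = P -> \tr P = (\rank P)%:R.
Proof.
move=> PP; have RC : row_base P *m col_base P = 1%:M.
  apply: (row_full_inj (A := col_base P)); first exact: col_base_full.
  apply: (row_free_inj (A := row_base P)); first exact: row_base_free.
  by rewrite /= mulmx1 mulmxA -mulmxA !mulmx_base PP.
by rewrite -[in LHS](mulmx_base P) mxtrace_mulC RC mxtrace1.
Qed.

Section RegularTrace.
Variables (F : fieldType) (E : falgType F).
Let d := \dim {:E}.
Let b : d.-tuple E := vbasis {:E}.

(** The regular representation: left multiplication by [a] in the basis [b]. *)
Definition regmx (a : E) : 'M[F]_d := \matrix_(j, i) coord b j (a * b`_i).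

Lemma full_coord (z : E) : z = \sum_j coord b j z *: b`_j.
Proof. by apply: coord_vbasis; rewrite memvf. Qed.

Lemma regmxE a (i : 'I_d) : a * b`_i = \sum_j regmx a j i *: b`_j.
Proof. by rewrite [LHS]full_coord; apply: eq_bigr => j _; rewrite mxE. Qed.

Lemma regmxM a a' : regmx (a * a') = regmx a *m regmx a'.
Proof.
apply/matrixP => j i; rewrite !mxE -mulrA regmxE mulr_sumr linear_sum.
by apply: eq_bigr => k _; rewrite -scalerAr linearZ /= mulrC !mxE.
Qed.

Lemma regmx_linear : linear regmx.
Proof.
move=> c u v; apply/matrixP => j i; rewrite !mxE mulrDl -scalerAl.
by rewrite linearP.
Qed.
HB.instance Definition _ := GRing.isLinear.Build F E 'M[F]_d _ regmx regmx_linear.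

Lemma regmx_inj : injective regmx.
Proof.
apply: raddf_inj => a a0; rewrite -[a]mulr1 (full_coord 1) mulr_sumr.
rewrite big1 // => i _; rewrite -scalerAr regmxE big1 ?scaler0 // => j _.
by rewrite a0 mxE scale0r.
Qed.

Definition regtr (a : E) : F := \tr (regmx a).

Lemma regtr_linear : scalar regtr.
Proof. by move=> c u v; rewrite /regtr !linearP. Qed.
HB.instance Definition _ := GRing.isLinear.Build F E F _ regtr regtr_linear.

Lemma regtrC a a' : regtr (a * a') = regtr (a' * a).
Proof. by rewrite /regtr !regmxM mxtrace_mulC. Qed.

Hypothesis regtr_nondeg : forall a, (forall z, regtr (a * z) = 0) -> a = 0.

(** With [y] dual to the basis [x] for the trace form, left multiplication on the
    [x i] and right multiplication on the [y j] have the same matrix, namely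
    [regmx a].  The Casimir element [\sum_i x i * y i] pairs with [a] to
    [\tr (regmx a)], which is how [1] pairs with [a]; this equality is where
    the regular trace is better than any other nondegenerate trace. *)
Lemma separability_idempotent :
  exists x y : 'I_d -> E, \sum_i x i * y i = 1 /\
    forall a, exists c : 'M[F]_d, (forall i, a * x i = \sum_j c j i *: x j) /\
      (forall j, y j * a = \sum_i c j i *: y i).
Proof.
have inj u v : (forall z, regtr (u * z) = regtr (v * z)) -> u = v.
  move=> H; apply/eqP; rewrite -subr_eq0; apply/eqP/regtr_nondeg => z.
  by rewrite mulrBl linearB /= H subrr.
(* the Gram matrix of the trace form *)
pose G : 'M[F]_d := \matrix_(i, j) regtr (b`_i * b`_j).
have Gu : G \in unitmx.
  rewrite -row_free_unit -kermx_eq0; apply/eqP/row_matrixP => i; rewrite row0.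
  have : row i (kermx G) *m G = 0 by rewrite -row_mul mulmx_ker row0.
  move: (row i _) => r rG; pose a := \sum_(k < d) r 0 k *: b`_k.
  have a0 : a = 0.
    apply: regtr_nondeg => z; rewrite (full_coord z) mulr_sumr linear_sum big1 //.
    move=> j _; rewrite -scalerAr linearZ /= mulr_suml linear_sum /=.
    suff -> : \sum_k regtr (r 0 k *: b`_k * b`_j) = (r *m G) 0 j.
      by rewrite rG mxE mulr0.
    by rewrite mxE; apply: eq_bigr => k _; rewrite -scalerAl linearZ /= mxE.
  apply/rowP => k; rewrite mxE.
  have -> : r 0 k = coord b k a.
    by rewrite coord_sum_free // (basis_free (vbasisP _)).
  by rewrite a0 linear0.
pose y (j : 'I_d) := \sum_i invmx G j i *: b`_i.
have yb (j i : 'I_d) : regtr (y j * b`_i) = (j == i)%:R.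
  transitivity ((invmx G *m G) j i); last by rewrite mulVmx // mxE.
  rewrite mxE mulr_suml linear_sum; apply: eq_bigr => k _.
  by rewrite -scalerAl linearZ /= mxE.
have regmxy a (j i : 'I_d) : regtr (y j * (a * b`_i)) = regmx a j i.
  rewrite regmxE mulr_sumr linear_sum (bigD1 j) //= big1 => [|k kj].
    by rewrite -scalerAr linearZ /= yb eqxx mulr1 addr0.
  by rewrite -scalerAr linearZ /= yb eq_sym (negPf kj) mulr0.
exists (fun i : 'I_d => b`_i), y; split.
  apply: inj => a; rewrite regtrC mulr_sumr linear_sum mul1r.
  by apply: eq_bigr => i _; rewrite /= mulrA regtrC regmxy.
move=> a; exists (regmx a); split=> [i|j]; first exact: regmxE.
apply: inj => z; rewrite (full_coord z) !mulr_sumr !linear_sum.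
apply: eq_bigr => k _; rewrite -!scalerAr !linearZ /=; congr (_ * _).
rewrite -mulrA regmxy mulr_suml linear_sum (bigD1 k) //= big1 => [|i ik].
  by rewrite -scalerAl linearZ /= yb eqxx mulr1 addr0.
by rewrite -scalerAl linearZ /= yb (negPf ik) mulr0.
Qed.

End RegularTrace.

(** * The algebra of a semisimple point *)

Lemma horner_mx_fix (F : fieldType) n (x : 'M[F]_n.+1) (w : 'cV[F]_n.+1) p :
  x *m w = w -> horner_mx x p *m w = p.[1] *: w.
Proof.
move=> xw; elim/poly_ind: p => [|p c IHp]; first by
  rewrite rmorph0 horner0 mul0mx scale0r.
rewrite rmorphD rmorphM /= horner_mx_X horner_mx_C hornerMXaddC mulr1.
by rewrite mulmxDl -mulmxA xw IHp mul_scalar_mx scalerDl.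
Qed.

(** The spectral idempotent of [x] at the eigenvalue 1.  The factor ['X] puts it
    in every right or left ideal that contains [x]. *)
Lemma fixed_vector_idem (F : fieldType) n (x : 'M[F]_n.+1) (w : 'cV[F]_n.+1) :
  x *m w = w -> w != 0 -> exists p : {poly F},
    let e := horner_mx x (p * 'X) in e *m e = e /\ e != 0.
Proof.
move=> xw w0; have [m [q q1 Dch]] := multiplicity_XsubC (char_poly x) 1.
rewrite (monic_neq0 (char_poly_monic x)) /= in q1.
(* 1 is an eigenvalue, so Cayley-Hamilton forces a factor 'X - 1 *)
have m0 : (0 < m)%N.
  case: m Dch => // Dch; case/negP: q1; rewrite expr0 mulr1 in Dch.
  have := horner_mx_fix q xw; rewrite -Dch Cayley_Hamilton mul0mx => /esym/eqP.
  by rewrite scaler_eq0 (negPf w0) orbF.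
have /Bezout_eq1_coprimepP[[u v] /= Duv] :
    coprimep (('X - 1%:P) ^+ m) (q * 'X).
  rewrite coprimep_pexpl // coprimep_sym coprimep_XsubC rootM negb_or q1.
  by rewrite rootX oner_eq0.
pose p := v * q.
have Dp : p * 'X = 1 - u * ('X - 1%:P) ^+ m.
  by rewrite -Duv addrAC subrr add0r mulrA.
exists p; set e := horner_mx x _; split.
  apply/eqP; rewrite -subr_eq0; apply/eqP.
  rewrite -[e *m e]/(e * e) -[X in _ - X]mulr1 -(rmorph1 (horner_mx x)).
  rewrite -mulrBr -rmorphB -rmorphM [X in _ * (X - _)]Dp.
  have -> : p * 'X * (1 - u * ('X - 1%:P) ^+ m - 1) =
      - (v * 'X * u) * (q * ('X - 1%:P) ^+ m).
    rewrite /p; ring.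
  by rewrite -Dch rmorphM /= Cayley_Hamilton mulr0.
apply: contra_neq w0 => e0; have := horner_mx_fix (p * 'X) xw.
rewrite -/e e0 mul0mx Dp !hornerE /= subrr expr0n gtn_eqF //= mulr0 subr0.
rewrite scale1r.
by move->.
Qed.

Section PtAlg.
Variables (R : realType) (g s : nat) (Y : ncpt R g s.+1).
Local Notation C := R[i].
Local Notation M := 'M[C]_s.+1.

(** Linear combinations of words in the components of [Y] exhaust the algebra,
    as [agenv] is a sum of powers of the span of the generators. *)
Lemma pt_alg_ind (P : M -> Prop) :
  (forall c a b, P a -> P b -> P (c *: a + b)) -> P 1 ->
  (forall i a, P a -> P (Y i * a)) -> forall a, a \in pt_alg Y -> P a.
Proof.
move=> PD P1 PM; have P0 : P 0 by rewrite -[0](addNr 1) -scaleN1r; apply: PD.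
have Psum (I : finType) (c : I -> C) F : (forall i, P (F i)) -> P (\sum_i c i *: F i).
  by move=> PF; elim/big_rec: _ => // i a _; exact: PD.
have PX k a : a \in (<<codom Y>> ^+ k)%VS -> P a.
  elim: k a => [|k IHk] a.
    by move=> /vlineP[c ->]; rewrite -[_ *: _]addr0; apply: PD.
  rewrite expvSl unlock => /coord_span ->; apply: (Psum) => i.
  rewrite -tnth_nth; have := mem_tnth i (allpairs_tuple *%R (vbasis <<codom Y>>)
    (vbasis (<<codom Y>> ^+ k))) => /allpairsP[[u v] /= [Uu Vv ->]].
  have /coord_span -> := vbasis_mem Uu; rewrite mulr_suml.
  under eq_bigr do rewrite -scalerAl; apply: (Psum) => j.
  rewrite -tnth_nth; have := mem_tnth j (codom_tuple Y) => /codomP[l ->].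
  by apply/PM/IHk/vbasis_mem.
move=> a /memv_sumP[v Hv ->].
have := @Psum _ (fun=> 1) v; under eq_bigr do rewrite scale1r.
by apply=> i; apply: (PX i); exact: Hv.
Qed.

Lemma pt_alg1 : 1 \in pt_alg Y.
Proof. by rewrite memvE sub1_agenv. Qed.

Lemma pt_alg_gen i : Y i \in pt_alg Y.
Proof. by apply: (subvP (sub_agenv _)); apply/memv_span/codom_f. Qed.

Lemma pt_alg_mul a b : a \in pt_alg Y -> b \in pt_alg Y -> a * b \in pt_alg Y.
Proof. exact: memvM. Qed.

Lemma pt_alg_horner a p : a \in pt_alg Y -> horner_mx a p \in pt_alg Y.
Proof.
move=> Aa; elim/poly_ind: p => [|p c IHp]; first by rewrite rmorph0 mem0v.
rewrite rmorphD rmorphM /= horner_mx_X horner_mx_C memvD ?pt_alg_mul //.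
by rewrite -[_%:M]mulmx1 mul_scalar_mx memvZ ?pt_alg1.
Qed.

Lemma invariant_alg W a v :
  invariant_subspace Y W -> a \in pt_alg Y -> v \in W -> a *m v \in W.
Proof.
move=> Winv Aa Wv; move: a Aa; apply: pt_alg_ind => [c a b Pa Pb||i a Pa].
- by rewrite mulmxDl -scalemxAl memvD ?memvZ.
- by rewrite mul1mx.
- by rewrite -mulmxA; exact: Winv.
Qed.

Lemma val1_pt : val (1 : subvs_of (pt_alg Y)) = 1.
Proof. by apply/eqP; rewrite /= algid_eq1 pt_alg1. Qed.

Lemma valM_pt (a b : subvs_of (pt_alg Y)) : val (a * b) = val a * val b.
Proof. by []. Qed.

Hypothesis Yss : semisimple_pt Y.

(** The cyclic submodule A(av) has an invariant complement; decompose
    v = u + w along it.  The component a w vanishes, being in both summands, so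
    av = au with u = b(av). *)
Lemma semisimple_fix (a : M) (v : 'cV[C]_s.+1) : a \in pt_alg Y ->
  exists2 b, b \in pt_alg Y & (a * b) *m (a *m v) = a *m v.
Proof.
move=> Aa; pose ev (b : M) : 'cV[C]_s.+1 := b *m (a *m v).
have ev_lin : linear ev by move=> c b b'; rewrite /ev mulmxDl scalemxAl.
pose evL := GRing.isLinear.Build C M 'cV[C]_s.+1 _ ev ev_lin.
pose ev' : {linear M -> 'cV[C]_s.+1} := HB.pack ev evL.
pose U := (linfun ev' @: pt_alg Y)%VS.
have Uinv : invariant_subspace Y U.
  move=> i w /memv_imgP[b Ab ->]; apply/memv_imgP; exists (Y i * b).
    by rewrite pt_alg_mul ?pt_alg_gen.
  by rewrite !lfunE /= /ev -!mulmxA.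
have [W [Winv UW UW0]] := Yss Uinv.
have : v \in (U + W)%VS by rewrite UW memvf.
case/memv_addP=> u Uu [w Ww Dv].
have aw0 : a *m w = 0.
  apply/eqP; rewrite -memv0 -UW0 memv_cap (invariant_alg Winv) // andbT.
  have -> : a *m w = a *m v - a *m u by rewrite Dv mulmxDr addrAC subrr add0r.
  apply: memvB; last exact: (invariant_alg Uinv).
  apply/memv_imgP; exists 1; first exact: pt_alg1.
  by rewrite lfunE /= /ev mul1mx.
have /memv_imgP[b Ab Du] := Uu; exists b => //.
move: Du; rewrite lfunE /= /ev => Du.
by rewrite -[_ * _]/(_ *m _) -mulmxA -Du Dv mulmxDr aw0 addr0.
Qed.

(** If [a != 0] annihilates the trace form, [semisimple_fix] gives an element of
    a A with eigenvalue 1, hence a nonzero idempotent [e] in a A.  Its regular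
    trace is the rank of left multiplication by [e], which is not zero in
    characteristic 0. *)
Lemma pt_regtr_nondeg (a : subvs_of (pt_alg Y)) :
  (forall z, regtr (a * z) = 0) -> a = 0.
Proof.
move=> ta; apply: contrapT => /eqP; rewrite -subr_eq0 subr0 => a0.
have [v v0] : exists v, val a *m v != 0 :> 'cV[C]_s.+1.
  apply: contrapT => H; case/eqP: a0; apply: val_inj; change (val a = 0).
  apply/matrixP => i j; have /negP := (forallNP _).2 H (delta_mx j 0).
  by rewrite -colE negbK => /eqP/matrixP/(_ i 0); rewrite !mxE.
have [b Ab Dab] := semisimple_fix v (subvsP a).
have [p [ee e0]] := fixed_vector_idem Dab v0.
pose x := val a * b; pose h := b * horner_mx x p.
have Ax : x \in pt_alg Y by rewrite pt_alg_mul ?(subvsP a).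
have Ah : h \in pt_alg Y by rewrite pt_alg_mul ?pt_alg_horner.
pose e := a * vsproj (pt_alg Y) h.
have De : val e = horner_mx x (p * 'X).
  by rewrite valM_pt /= vsprojK // mulrA -/x [p * 'X]mulrC rmorphM /= horner_mx_X.
have eI : e * e = e by apply: val_inj; rewrite valM_pt De.
have := ta (vsproj _ h); rewrite -/e /regtr mxtrace_idem -?regmxM ?eI //.
move/eqP.
rewrite pnatr_eq0 mxrank_eq0 -(linear0 (@regmx C _)) => /eqP/regmx_inj E0.
by move: e0; rewrite -De E0 eqxx.
Qed.

End PtAlg.

(** * Matrix algebras without square-zero elements *)

Section Reduced.
Variables (F : closedFieldType) (n : nat) (S : {pred 'M[F]_n.+1}).
Hypothesis SM : forall a b, a \in S -> b \in S -> a * b \in S.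
Hypothesis Sp : forall a p, a \in S -> horner_mx a p \in S.
Hypothesis Sred : forall a, a \in S -> a * a = 0 -> a = 0.

(** The product of the distinct linear factors of the minimal polynomial is
    nilpotent at [a], so it vanishes at [a]. *)
Lemma reduced_diagonalizable a : a \in S -> diagonalizable a.
Proof.
move=> Sa; apply/diagonalizableP.
have [rs Drs] := closed_field_poly_normal (mxminpoly a).
rewrite (monicP (mxminpoly_monic a)) scale1r in Drs.
exists (undup rs); first exact: undup_uniq.
set q := \prod_(z <- undup rs) _; apply: mxminpoly_min.
have qN : mxminpoly a %| q ^+ size rs.
  have qz z : z \in rs -> 'X - z%:P %| q.
    by rewrite -mem_undup => zu; rewrite /q (big_rem z) //= dvdp_mulr.
  rewrite Drs; move: q qz => q; elim: (rs) => [|z l IHl] qz.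
    by rewrite big_nil dvd1p.
  rewrite big_cons exprS dvdp_mul ?qz ?mem_head // IHl // => t tl.
  by rewrite qz // in_cons tl orbT.
have nil k : forall b, b \in S -> b ^+ (2 ^ k) = 0 -> b = 0.
  elim: k => [|k IHk] b Sb; first by rewrite expr1.
  rewrite expnS exprM => /IHk b2; apply: Sred => //; rewrite -expr2; apply: b2.
  by rewrite expr2; exact: SM.
apply: (nil (size rs)); first exact: Sp.
apply/eqP; rewrite -rmorphXn -dvd_mxminpoly.
apply: dvdp_trans qN _.
by apply: dvdp_exp2l; rewrite ltnW // ltn_expl.
Qed.

Lemma horner_mx_eigen (a : 'M[F]_n.+1) r (v : 'rV_n.+1) p :
  v *m a = r *: v -> v *m horner_mx a p = p.[r] *: v.
Proof.
move=> va; elim/poly_ind: p => [|p c IHp].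
  by rewrite rmorph0 horner0 mulmx0 scale0r.
rewrite rmorphD rmorphM /= horner_mx_X horner_mx_C hornerMXaddC.
by rewrite mulmxDr mulmxA IHp -scalemxAl va scalerA mul_mx_scalar scalerDl.
Qed.

(** Eigenspaces of [a] are stable under [b]: with [u] a multiple of the spectral
    projection at [r], the element [u * b * (a - r)] has square zero because
    [(a - r) * u = 0]. *)
Lemma reduced_eigen a b r (v : 'rV_n.+1) : a \in S -> b \in S ->
  v *m a = r *: v -> v *m b *m a = r *: (v *m b).
Proof.
move=> Sa Sb va; have [->|v0] := eqVneq v 0; first by rewrite !mul0mx scaler0.
have /diagonalizableP[rs rs_uniq dvd_rs] := reduced_diagonalizable Sa.
have r_rs : r \in rs.
  rewrite -root_prod_XsubC (root_dvdp dvd_rs) //.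
  by rewrite -eigenvalue_root_min; apply/eigenvalueP; exists v.
pose q := \prod_(z <- rem r rs) ('X - z%:P).
have qr : q.[r] != 0.
  by rewrite -[_ == 0]/(root q r) root_prod_XsubC mem_rem_uniqF.
pose u := horner_mx a q; pose t := horner_mx a ('X - r%:P).
have tu : t * u = 0.
  by rewrite -rmorphM; apply/mxminpoly_minP; rewrite (big_rem r) in dvd_rs.
have ubt : u * b * t = 0.
  apply: Sred; first by rewrite !SM ?Sp.
  by rewrite -!mulrA [t * (u * _)]mulrA tu mul0r !mulr0.
have : v *m (u * b * t) = 0 by rewrite ubt mulmx0.
rewrite /t rmorphB /= horner_mx_X horner_mx_C !mulmxA (horner_mx_eigen q va).
rewrite -!scalemxAl mulmxBr mul_mx_scalar => /eqP.
by rewrite scaler_eq0 (negPf qr) subr_eq0 => /eqP.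
Qed.

Lemma reduced_comm a b : a \in S -> b \in S -> comm_mx a b.
Proof.
move=> Sa Sb; have [P Pu /diagonalizable_forPex[d /(simmxP Pu) Pa]] :=
  reduced_diagonalizable Sa.
apply: (can_inj (mulKmx Pu)); apply/row_matrixP => i.
have vi : row i P *m a = d 0 i *: row i P.
  by rewrite -row_mul Pa; apply/rowP => j; rewrite mul_diag_mx !mxE.
by rewrite !mulmxA !row_mul (reduced_eigen Sa Sb vi) vi -scalemxAl.
Qed.

End Reduced.

(** * Algebras containing a full set of matrix units *)

Section MatrixUnits.
Variables (K : comNzRingType) (O : algType K) (n : nat).
Variable e : 'I_n.+1 -> 'I_n.+1 -> O.

Definition centralizer : {pred O} :=
  fun a => `[< forall i j, a * e i j = e i j * a >].

Lemma centralizerP a : reflect (forall i j, a * e i j = e i j * a) (a \in centralizer).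
Proof. exact: asboolP. Qed.

Fact centralizer_subalg : GRing.subalg_closed centralizer.
Proof.
split=> [|c a b|a b].
- by apply/centralizerP => i j; rewrite mul1r mulr1.
- move=> /centralizerP Ca /centralizerP Cb; apply/centralizerP => i j.
  by rewrite mulrDl mulrDr -scalerAl -scalerAr Ca Cb.
- move=> /centralizerP Ca /centralizerP Cb; apply/centralizerP => i j.
  by rewrite -mulrA Cb mulrA Ca mulrA.
Qed.
HB.instance Definition _ := GRing.isSubalgClosed.Build K O centralizer centralizer_subalg.

Record cent := Cent { cent_val : O; cent_valP : cent_val \in centralizer }.
HB.instance Definition _ := [isSub for cent_val].
HB.instance Definition _ := [Choice of cent by <:].
HB.instance Definition _ := [SubChoice_isSubAlgebra of cent by <:].

Hypothesis eM : forall i j k l, e i j * e k l = if j == k then e i l else 0.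
Hypothesis e1 : \sum_i e i i = 1.

(** These sums are the matrix coefficients of [f]: averaging [f] over the matrix
    units makes it commute with them. *)
Fact munit_coef_cent f i j : \sum_k e k i * f * e j k \in centralizer.
Proof.
apply/centralizerP => p q; rewrite mulr_suml mulr_sumr.
rewrite (bigD1 p) //= [RHS](bigD1 q) //= -!mulrA !eM eqxx mulrA !mulrA !eM eqxx.
rewrite !big1 // => k kp; rewrite ?mulrA ?eM.
  by rewrite eq_sym (negPf kp) !mul0r.
by rewrite -mulrA eM (negPf kp) mulr0.
Qed.

Definition munit_coef f i j := Cent (munit_coef_cent f i j).

Definition munit_mx (f : O) : 'M[cent]_n.+1 := \matrix_(i, j) munit_coef f i j.

Fact munit_mx_zmod : zmod_morphism munit_mx.
Proof.
move=> f h; apply/matrixP => i j; rewrite !mxE; apply: val_inj; rewrite rmorphB /= -sumrB.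
by apply: eq_bigr => k _; rewrite mulrBr mulrBl.
Qed.

Fact munit_mx_monoid : monoid_morphism munit_mx.
Proof.
split.
  apply/matrixP => i j; rewrite !mxE; apply: val_inj => /=.
  under eq_bigr do rewrite mulr1 eM.
  by have [_|_] := eqVneq i j; rewrite ?e1 ?big1.
move=> f h; apply/matrixP => i j; rewrite !mxE; apply: val_inj.
rewrite rmorph_sum /=.
under [RHS]eq_bigr => l _ do rewrite mxE [munit_mx h l j]mxE /=.
transitivity (\sum_l \sum_k e k i * f * e l l * h * e j k).
  rewrite exchange_big; apply: eq_bigr => k _.
  rewrite mulrA -[e k i * f in LHS]mulr1 -e1.
  by rewrite mulr_sumr !mulr_suml.
apply: eq_bigr => l _; rewrite mulr_suml; apply: eq_bigr => k _.
rewrite mulr_sumr (bigD1 k) //= big1 => [|m mk].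
  by rewrite addr0 !mulrA -[_ * e l k * e k l]mulrA eM eqxx.
by rewrite !mulrA -[_ * e l k * e m l]mulrA eM eq_sym (negPf mk) mulr0 !mul0r.
Qed.


Lemma munit_mx_bij : bijective munit_mx.
Proof.
exists (fun A : 'M[cent]_n.+1 => \sum_i \sum_j cent_val (A i j) * e i j) => [f|A].
  transitivity (\sum_i \sum_j e i i * f * e j j).
    apply: eq_bigr => i _; apply: eq_bigr => j _; rewrite mxE /=.
    rewrite mulr_suml (bigD1 i) //= big1 => [|k ki].
      by rewrite addr0 -mulrA eM eqxx.
    by rewrite -mulrA eM (negPf ki) mulr0.
  rewrite -[RHS]mulr1 -[X in X * _]mul1r -e1 !mulr_suml; apply: eq_bigr => i _.
  by rewrite mulr_sumr.
apply/matrixP => p q; rewrite mxE; apply: val_inj => /=.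
transitivity (\sum_k cent_val (A p q) * e k k); last by rewrite -mulr_sumr e1 mulr1.
apply: eq_bigr => k _.
rewrite mulr_sumr mulr_suml (bigD1 p) //= [X in _ + X]big1 => [|i ip].
  rewrite addr0 mulr_sumr mulr_suml (bigD1 q) //= [X in _ + X]big1 => [|j jq].
    rewrite addr0 mulrA -(centralizerP _ (cent_valP (A p q)) k p) -!mulrA.
    by rewrite !(eM, eqxx).
  by rewrite -!mulrA eM (negPf jq) !mulr0.
rewrite mulr_sumr mulr_suml big1 // => j _.
rewrite mulrA -(centralizerP _ (cent_valP (A i j)) k p) -!mulrA.
by rewrite [e k p * _]mulrA eM eq_sym (negPf ip) mul0r mulr0.
Qed.

Lemma munit_mxZ c f : munit_mx (c *: f) = map_mx (fun a => c *: a) (munit_mx f).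
Proof.
apply/matrixP => i j; rewrite !mxE; apply: val_inj; rewrite linearZ /= scaler_sumr.
by apply: eq_bigr => k _; rewrite -scalerAr -scalerAl.
Qed.

End MatrixUnits.

(** The algebra of coefficients is the centralizer of the matrix units. *)
Lemma matrix_units_iso (K : comNzRingType) (O : algType K) (n : nat)
    (e : 'I_n.+1 -> 'I_n.+1 -> O) :
  (forall i j k l, e i j * e k l = if j == k then e i l else 0) ->
  \sum_i e i i = 1 ->
  exists (A : algType K) (phi : {rmorphism O -> 'M[A]_n.+1}),
    bijective phi /\
    forall c f, phi (c *: f) = map_mx (fun a : A => c *: a) (phi f).
Proof.
move=> eM e1; pose h := @munit_mx _ _ _ _ eM.
pose hadd := GRing.isZmodMorphism.Build _ _ h (munit_mx_zmod eM).
pose hmon := GRing.isMonoidMorphism.Build _ _ h (munit_mx_monoid eM e1).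
pose phi : {rmorphism O -> 'M[cent e]_n.+1} := HB.pack h hadd hmon.
exists (cent e), phi; split; [exact: munit_mx_bij|exact: munit_mxZ].
Qed.

(** * Geometrically convergent sequences of complex matrices *)

Section Rapid.
Local Open Scope classical_set_scope.
Local Open Scope complex_scope.
Variable R : realType.
Local Notation C := R[i].
Local Notation normc := (@Normc.normc R).

Lemma normcN (z : C) : normc (- z) = normc z.
Proof. by case: z => a b; rewrite /= !sqrrN. Qed.

Lemma le_Re_normc (z : C) : `|complex.Re z| <= normc z.
Proof.
case: z => a b /=; rewrite -sqrtr_sqr ler_wsqrtr // lerDl sqr_ge0 //.
Qed.

Lemma le_Im_normc (z : C) : `|complex.Im z| <= normc z.
Proof.
case: z => a b /=; rewrite -sqrtr_sqr ler_wsqrtr // lerDr sqr_ge0 //.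
Qed.

Lemma normc_le_ReIm (z : C) : normc z <= `|complex.Re z| + `|complex.Im z|.
Proof.
case: z => a b /=; rewrite -[leRHS]ger0_norm ?addr_ge0 // -sqrtr_sqr ler_wsqrtr //.
by rewrite sqrrD !real_normK ?num_real // addrAC lerDl mulrn_wge0 ?mulr_ge0.
Qed.

Let half k : R := 2^-1 ^+ k.
Local Lemma half_ge0 k : 0 <= half k. Proof. by rewrite exprn_ge0 // invr_ge0. Qed.
Local Lemma half_le1 k : half k <= 1.
Proof. by rewrite exprn_ile1 ?invr_ge0 // invf_le1 // ler1n. Qed.
Local Lemma halfS k : half k = 2 * half k.+1.
Proof. by rewrite /half exprS mulrA mulfV ?mul1r // pnatr_eq0. Qed.

(** The form of the archimedean property in which limits are used below. *)
Lemma half_le0 (x K : R) : (forall k, x <= K * half k) -> x <= 0.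
Proof.
move=> H; rewrite leNgt; apply/negP => xp; pose k := Num.truncn (K / x).
have Kk : K / x < 2 ^+ k.+1.
  apply: lt_le_trans (truncnS_gt _) _.
  by rewrite -natrX ler_nat ltnW // ltn_expl.
have := H k.+1; rewrite /half exprVn leNgt => /negP; apply.
by rewrite ltr_pdivrMr ?exprn_gt0 // mulrC -ltr_pdivrMr.
Qed.

(** Shifting the sequence down, respectively up, by its possible remaining
    variation makes it increasing, respectively decreasing; the limit is the
    supremum of the first. *)
Lemma geometric_cauchy (x : nat -> R) (K : R) :
  (forall k, `|x k.+1 - x k| <= K * half k) ->
  exists l, forall k, `|x k - l| <= 2 * K * half k.
Proof.
move=> H; have K0 : 0 <= K by have := H 0%N; rewrite /half expr0 mulr1; exact: le_trans.
pose a k := x k - 2 * K * half k; pose b k := x k + 2 * K * half k.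
have aS k : a k <= a k.+1.
  by have := H k; rewrite /a halfS ler_norml => /andP[? ?]; nra.
have bS k : b k.+1 <= b k.
  by have := H k; rewrite /b halfS ler_norml => /andP[? ?]; nra.
have ah : {homo a : i j / (i <= j)%N >-> i <= j}.
  by apply: homo_leq => //; exact: le_trans.
have bh : {homo b : i j / (i <= j)%N >-> j <= i}.
  apply: (homo_leq (r := fun p q => q <= p)) => // y z t zy ty.
  exact: le_trans ty zy.
have ab i j : a i <= b j.
  apply: le_trans (ah i (maxn i j) (leq_maxl _ _)) _.
  apply: le_trans (bh j (maxn i j) (leq_maxr _ _)).
  by rewrite /a /b; have := half_ge0 (maxn i j); nra.
pose A := [set a k | k in [set: nat]].
have supA : has_sup A.
  by split; [exists (a 0%N), 0%N|exists (b 0%N) => _ [k _ <-]].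
exists (sup A) => k; rewrite ler_norml.
have h1 : a k <= sup A by apply: (sup_upper_bound supA); exists k.
have h2 : sup A <= b k by apply: ge_sup; [case: supA|move=> _ [j _ <-]].
by rewrite /a /b in h1 h2; apply/andP; split; lra.
Qed.

(** Convergence at geometric rate.  All limits below are of this kind, and the
    explicit rate makes compatibility with sums and products a computation. *)
Definition rapid (u : nat -> C) (l : C) :=
  exists K : R, forall k, normc (u k - l) <= K * half k.

Lemma rapid_ex (u : nat -> C) (K : R) :
  (forall k, normc (u k.+1 - u k) <= K * half k) -> exists l, rapid u l.
Proof.
move=> H.
have [k|a aP] := @geometric_cauchy (fun k => complex.Re (u k)) K.
  by apply: le_trans (H k); rewrite -raddfB; exact: le_Re_normc.
have [k|b bP] := @geometric_cauchy (fun k => complex.Im (u k)) K.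
  by apply: le_trans (H k); rewrite -raddfB; exact: le_Im_normc.
exists (a +i* b), (2 * K + 2 * K) => k; rewrite mulrDl.
apply: le_trans (normc_le_ReIm _) _; rewrite !raddfB /=.
by apply: lerD; [exact: aP|exact: bP].
Qed.

Lemma rapid_unique u l l' : rapid u l -> rapid u l' -> l = l'.
Proof.
move=> [K H] [K' H']; apply/eqP; rewrite -subr_eq0; apply/eqP/Normc.eq0_normc.
apply/eqP; rewrite eq_le normc_ge0 andbT; apply: (@half_le0 _ (K + K')) => k.
have -> : l - l' = (u k - l') - (u k - l) by ring.
by rewrite mulrDl addrC; apply: le_trans (le_normcD _ _) _; rewrite normcN lerD.
Qed.

Lemma rapid_cst l : rapid (fun=> l) l.
Proof. by exists 0 => k; rewrite subrr Normc.normc0 mul0r. Qed.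

Lemma rapidD u v l m : rapid u l -> rapid v m -> rapid (fun k => u k + v k) (l + m).
Proof.
move=> [K H] [K' H']; exists (K + K') => k; rewrite mulrDl.
by rewrite opprD addrACA; apply: le_trans (le_normcD _ _) _; exact: lerD.
Qed.

Lemma rapidM u v l m : rapid u l -> rapid v m -> rapid (fun k => u k * v k) (l * m).
Proof.
move=> [K H] [K' H']; exists (K * (K' + normc m) + normc l * K') => k.
have K0 : 0 <= K.
  by have := le_trans (normc_ge0 _) (H 0%N); rewrite /half expr0 mulr1.
have K0' : 0 <= K'.
  by have := le_trans (normc_ge0 _) (H' 0%N); rewrite /half expr0 mulr1.
have -> : u k * v k - l * m = (u k - l) * v k + l * (v k - m) by ring.
apply: le_trans (le_normcD _ _) _; rewrite !Normc.normcM mulrDl.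
apply: lerD; last by rewrite -mulrA ler_wpM2l ?normc_ge0.
rewrite mulrAC; apply: ler_pM; rewrite ?normc_ge0 //.
rewrite -[v k](subrK m); apply: le_trans (le_normcD _ _) _; rewrite lerD2r.
apply: le_trans (H' k) _; rewrite ler_piMr //; exact: half_le1.
Qed.

Lemma rapid_sum (I : finType) (u : I -> nat -> C) (l : I -> C) :
  (forall i, rapid (u i) (l i)) -> rapid (fun k => \sum_i u i k) (\sum_i l i).
Proof.
move=> H; elim: (index_enum I) => [|i s IHs].
  rewrite big_nil; have := rapid_cst 0; congr rapid.
  by apply: funext => k; rewrite big_nil.
rewrite big_cons; have := rapidD (H i) IHs; congr rapid.
by apply: funext => k; rewrite big_cons.
Qed.

(** Entrywise convergence, so that it applies to products with rectangular
    matrices, on which [opnorm] is not defined. *)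
Definition mrapid m n (u : nat -> 'M[C]_(m, n)) (L : 'M[C]_(m, n)) :=
  forall i j, rapid (fun k => u k i j) (L i j).

Lemma mrapid_unique m n (u : nat -> 'M[C]_(m, n)) L L' :
  mrapid u L -> mrapid u L' -> L = L'.
Proof. by move=> H H'; apply/matrixP => i j; apply: rapid_unique (H i j) (H' i j). Qed.

Lemma mrapid_cst m n (L : 'M[C]_(m, n)) : mrapid (fun=> L) L.
Proof. by move=> i j; exact: rapid_cst. Qed.

Lemma mrapidD m n (u v : nat -> 'M[C]_(m, n)) L L' :
  mrapid u L -> mrapid v L' -> mrapid (fun k => u k + v k) (L + L').
Proof.
move=> H H' i j; rewrite mxE; have := rapidD (H i j) (H' i j).
by congr rapid; apply: funext => k; rewrite mxE.
Qed.

Lemma mrapidM m n p (u : nat -> 'M[C]_(m, n)) (v : nat -> 'M[C]_(n, p)) L L' :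
  mrapid u L -> mrapid v L' -> mrapid (fun k => u k *m v k) (L *m L').
Proof.
move=> H H' i j; rewrite mxE.
have := rapid_sum (fun q => rapidM (H i q) (H' q j)).
by congr rapid; apply: funext => k; rewrite mxE.
Qed.

Lemma mrapidZ m n c (u : nat -> 'M[C]_(m, n)) L :
  mrapid u L -> mrapid (fun k => c *: u k) (c *: L).
Proof.
move=> H i j; rewrite mxE; have := rapidM (rapid_cst c) (H i j).
by congr rapid; apply: funext => k; rewrite mxE.
Qed.

Definition mlim m n (u : nat -> 'M[C]_(m, n)) : 'M[C]_(m, n) :=
  xget 0 [set L | mrapid u L].

Lemma mlimE m n (u : nat -> 'M[C]_(m, n)) L : mrapid u L -> mlim u = L.
Proof.
move=> uL; rewrite /mlim; case: xgetP => [L' _ /= uL'|/(_ L)/(_ uL)//].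
exact: mrapid_unique uL' uL.
Qed.

Lemma l2norm_delta n (j : 'I_n) : l2norm (delta_mx j 0 : 'cV[C]_n) = 1.
Proof.
rewrite /l2norm (bigD1 j) //= big1 => [|k kj].
  by rewrite !mxE !eqxx Normc.normc1 expr1n addr0 sqrtr1.
by rewrite mxE (negPf kj) Normc.normc0 expr0n.
Qed.

Lemma l2norm_le_sum n (v : 'cV[C]_n) : l2norm v <= \sum_i normc (v i 0).
Proof.
have -> : l2norm v = l2norm (\sum_i v i 0 *: (delta_mx i 0 : 'cV[C]_n)).
  by rewrite [in LHS](matrix_sum_delta v); under eq_bigr do rewrite big_ord1.
apply: le_trans (l2norm_sum _) _; apply: ler_sum => i _.
by rewrite l2normZ l2norm_delta mulr1.
Qed.

Lemma normc_le_opnorm n (A : 'M[C]_n) i j : normc (A i j) <= opnorm A.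
Proof.
have -> : A i j = (A *m delta_mx j 0 : 'cV_n) i 0 by rewrite -colE mxE.
apply: le_trans (normc_le_l2norm _ _) _; apply: le_trans (opnormP _ _) _.
by rewrite l2norm_delta mulr1.
Qed.

Lemma mrapid_opnorm n (u : nat -> 'M[C]_n) L (c : R) : 0 <= c ->
  mrapid u L -> (forall k, opnorm (u k) <= c) -> opnorm L <= c.
Proof.
move=> c0 uL uc; apply: opnorm_le => // v.
have uvL := mrapidM uL (mrapid_cst v).
have /boolp.choice[K KP] i := uvL i 0.
rewrite -subr_le0; apply: (@half_le0 _ (\sum_i K i)) => k.
rewrite lerBlDl; apply: (@le_trans _ _ (l2norm (u k *m v) + l2norm (L *m v - u k *m v))).
  by rewrite -{1}[L *m v](subrK (u k *m v)) [X in l2norm X]addrC l2normD.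
apply: lerD; first by apply: le_trans (opnormP _ _) _; rewrite ler_wpM2r ?l2norm_ge0.
apply: le_trans (l2norm_le_sum _) _; rewrite mulr_suml; apply: ler_sum => i _.
by rewrite mxE [X in _ + X]mxE -normcN opprB.
Qed.

Lemma mrapid_ex n (u : nat -> 'M[C]_n) (K : R) :
  (forall k, opnorm (u k.+1 - u k) <= K * half k) -> mrapid u (mlim u).
Proof.
move=> H; suff [L uL] : exists L, mrapid u L by rewrite (mlimE uL).
have /boolp.choice[L LP] : forall ij : 'I_n * 'I_n,
    exists l, rapid (fun k => u k ij.1 ij.2) l.
  move=> [i j]; apply: (@rapid_ex _ K) => k; apply: le_trans (H k).
  by have := normc_le_opnorm (u k.+1 - u k) i j; rewrite !mxE.
by exists (\matrix_(i, j) L (i, j)) => i j; rewrite mxE; exact: (LP (i, j)).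
Qed.
End Rapid.

(** * Newton iteration towards a homomorphism *)

Section CoordNorm.
Variables (R : realType) (E : falgType R[i]).
Local Notation C := R[i].
Local Notation b := (vbasis {:E}).

(** Any fixed norm on the algebra would do; the l^1 norm of coordinates makes the
    norm of a linear map its maximum over the basis. *)
Definition cnorm (a : E) : R := \sum_i Normc.normc (coord b i a).

Lemma cnorm_ge0 a : 0 <= cnorm a.
Proof. by apply: sumr_ge0 => i _; exact: normc_ge0. Qed.

Lemma opnormZ_le n (c : C) (A : 'M[C]_n) :
  opnorm (c *: A) <= Normc.normc c * opnorm A.
Proof.
rewrite -mul_scalar_mx; apply: le_trans (opnormM _ _) _.
by rewrite ler_wpM2r ?opnorm_ge0 ?opnorm_scalar.
Qed.

Lemma opnormN n (A : 'M[C]_n) : opnorm (- A) = opnorm A.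
Proof.
suff H (B : 'M[C]_n) : opnorm (- B) <= opnorm B.
  by apply/eqP; rewrite eq_le H -{1}[A]opprK H.
rewrite -scaleN1r; apply: le_trans (opnormZ_le _ _) _.
by rewrite normcN Normc.normc1 mul1r.
Qed.

Lemma opnormB n (A B : 'M[C]_n) : opnorm (A - B) <= opnorm A + opnorm B.
Proof. by rewrite -[opnorm B]opnormN; exact: opnormD. Qed.

Lemma opnorm_sum n (I : finType) (F : I -> 'M[C]_n) :
  opnorm (\sum_i F i) <= \sum_i opnorm (F i).
Proof.
elim/big_rec2: _ => [|i u A _ le_u]; first by rewrite opnorm0.
by apply: le_trans (opnormD _ _) _; rewrite lerD2l.
Qed.

Lemma linear_opnorm n (f : E -> 'M[C]_n) (K : R) : linear f ->
  (forall i : 'I_(\dim {:E}), opnorm (f b`_i) <= K) ->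
  forall a, opnorm (f a) <= K * cnorm a.
Proof.
move=> f_lin fK a; pose fL := GRing.isLinear.Build C E 'M[C]_n _ f f_lin.
pose f' : {linear E -> 'M[C]_n} := HB.pack f fL.
rewrite -[f a]/(f' a) (full_coord a) linear_sum; apply: le_trans (opnorm_sum _) _.
rewrite -full_coord mulr_sumr; apply: ler_sum => i _; rewrite linearZ.
apply: le_trans (opnormZ_le _ _) _.
by rewrite mulrC ler_wpM2r ?normc_ge0.
Qed.

End CoordNorm.

Section Newton.
Variables (R : realType) (E : falgType R[i]) (d : nat) (x y : 'I_d -> E).
Local Notation C := R[i].

(** Measures the failure of multiplicativity; it satisfies the Hochschild
    2-cocycle identity exactly, [phi] standing for the action. *)
Definition defect n (phi : E -> 'M[C]_n) a b := phi (a * b) - phi a *m phi b.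

(** The contracting homotopy of Hochschild cohomology attached to the separability
    idempotent sum x_i (x) y_i, applied to the defect. *)
Definition newton_corr n (phi : E -> 'M[C]_n) a :=
  \sum_i phi (x i) *m defect phi (y i) a.

Definition newton n (phi : E -> 'M[C]_n) a := phi a + newton_corr phi a.

Fact newton_linear n (phi : {linear E -> 'M[C]_n}) : linear (newton phi).
Proof.
move=> c a b; rewrite /newton /newton_corr linearP scalerDr scaler_sumr addrACA.
rewrite -big_split /=; congr (_ + _); apply: eq_bigr => i _.
rewrite /defect mulrDr -scalerAr !linearP /= !mulmxDr -!scalemxAr.
by rewrite scalerDr addrACA.
Qed.
HB.instance Definition _ n (phi : {linear E -> 'M[C]_n}) :=
  GRing.isLinear.Build C E 'M[C]_n _ (newton phi) (newton_linear phi).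

Fixpoint newton_iter n (sigma : {linear E -> 'M[C]_n}) k : {linear E -> 'M[C]_n} :=
  if k is k'.+1 then newton (newton_iter sigma k') else sigma.

(** This is the form in which naturality in the point propagates along the
    iteration, for direct sums and similarities at once. *)
Lemma newton_intertwine n n' (T : 'M[C]_(n', n)) (phi : E -> 'M[C]_n)
    (phi' : E -> 'M[C]_n') :
  (forall a, T *m phi a = phi' a *m T) ->
  forall a, T *m newton phi a = newton phi' a *m T.
Proof.
move=> H a; rewrite /newton mulmxDr mulmxDl H mulmx_sumr mulmx_suml.
congr (_ + _); apply: eq_bigr => i _.
rewrite mulmxA H -!mulmxA; congr (_ *m _).
by rewrite /defect mulmxBr mulmxBl H mulmxA H -!mulmxA H.
Qed.

Hypothesis xy1 : \sum_i x i * y i = 1.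
Hypothesis xyC : forall a, exists c : 'M[C]_d,
  (forall i, a * x i = \sum_j c j i *: x j) /\
  (forall j, y j * a = \sum_i c j i *: y i).

Section Step.
Variables (n : nat) (phi : {linear E -> 'M[C]_n}).
Hypothesis phi1 : phi 1 = 1%:M.

Lemma newton1 : newton phi 1 = 1%:M.
Proof.
rewrite /newton /newton_corr big1 ?addr0 // => i _.
by rewrite /defect mulr1 phi1 mulmx1 subrr mulmx0.
Qed.

(** The Hochschild cocycle identity: both sides expand to the same four
    products. *)
Lemma defect_cocycle z a b :
  defect phi z (a * b) - defect phi z a *m phi b =
  defect phi (z * a) b - phi z *m defect phi a b.
Proof.
rewrite /defect mulrA mulmxBl mulmxBr !mulmxA.
by rewrite !opprB addrACA [RHS]addrACA [X in _ + X = _]addrC.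
Qed.

(** Separability: [a] can be moved across the tensor sum x_i (x) y_i inside any
    bilinear expression. *)
Lemma newton_balance a b :
  \sum_i phi (x i) *m defect phi (y i * a) b =
  \sum_i phi (a * x i) *m defect phi (y i) b.
Proof.
have [c [ax ya]] := xyC a.
transitivity (\sum_i \sum_j c i j *: (phi (x i) *m defect phi (y j) b)).
  apply: eq_bigr => i _; rewrite ya /defect mulr_suml !linear_sum mulmx_suml.
  rewrite -sumrB mulmx_sumr; apply: eq_bigr => j _.
  by rewrite -scalerAl !linearZ /= -scalemxAl -scalerBr -scalemxAr.
rewrite exchange_big; apply: eq_bigr => i _; rewrite ax linear_sum mulmx_suml.
by apply: eq_bigr => j _; rewrite linearZ /= -scalemxAl.
Qed.

(** The correction cancels the linear part of the defect: what remains is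
    quadratic in it, since the correction itself is linear in the defect.
    Unitality of [phi] is what removes the last linear term, through
    [\sum_i x i * y i = 1]. *)
Lemma newton_defect a b : defect (newton phi) a b =
  \sum_i defect phi a (x i) *m defect phi (y i) b
  + (\sum_i defect phi (x i) (y i)) *m defect phi a b
  - newton_corr phi a *m newton_corr phi b.
Proof.
set psi := newton_corr phi.
have sumxy : \sum_i phi (x i) *m phi (y i) = 1%:M - \sum_i defect phi (x i) (y i).
  rewrite -phi1 -xy1 linear_sum -sumrB; apply: eq_bigr => i _.
  by rewrite /defect opprB addrCA subrr addr0.
have psi_cob : psi (a * b) - phi a *m psi b - psi a *m phi b =
    \sum_i defect phi a (x i) *m defect phi (y i) b
    - (\sum_i phi (x i) *m phi (y i)) *m defect phi a b.
  have : psi (a * b) - psi a *m phi b =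
      \sum_i phi (a * x i) *m defect phi (y i) b
      - (\sum_i phi (x i) *m phi (y i)) *m defect phi a b.
    rewrite -newton_balance !mulmx_suml -!sumrB; apply: eq_bigr => i _.
    by rewrite -!mulmxA -!mulmxBr defect_cocycle.
  rewrite addrAC => ->; rewrite addrAC; congr (_ - _).
  rewrite /psi /newton_corr mulmx_sumr -sumrB; apply: eq_bigr => i _.
  by rewrite mulmxA -mulmxBl.
have -> : defect (newton phi) a b = defect phi a b
    + (psi (a * b) - phi a *m psi b - psi a *m phi b) - psi a *m psi b.
  rewrite {1}/defect /newton -/psi mulmxDl !mulmxDr /defect.
  move: (phi (a * b)) (psi (a * b)) (phi a *m phi b) (phi a *m psi b)
    (psi a *m phi b) (psi a *m psi b) => A1 A2 A3 A4 A5 A6.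
  by apply/matrixP => i j; rewrite !mxE; ring.
rewrite psi_cob sumxy mulmxBl mul1mx.
move: (\sum_i _) (defect phi a b) (_ *m _) (_ *m _) => A1 A2 A3 A4.
by apply/matrixP => i j; rewrite !mxE; ring.
Qed.
End Step.

(** Bounds the norm of the contracting homotopy. *)
Definition casimir_norm : R := \sum_i cnorm (x i) * cnorm (y i).
Local Notation K1 := casimir_norm.

Lemma casimir_norm_ge0 : 0 <= K1.
Proof. by apply: sumr_ge0 => i _; rewrite mulr_ge0 ?cnorm_ge0. Qed.

Section StepBounds.
Variables (n : nat) (phi : {linear E -> 'M[C]_n}) (M eta : R).
Hypothesis phi1 : phi 1 = 1%:M.
Hypothesis phiM : forall a, opnorm (phi a) <= M * cnorm a.
Hypothesis phiD : forall a b, opnorm (defect phi a b) <= eta * (cnorm a * cnorm b).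

Lemma newton_corr_bound a : opnorm (newton_corr phi a) <= M * K1 * eta * cnorm a.
Proof.
apply: le_trans (opnorm_sum _) _.
have -> : M * K1 * eta * cnorm a =
    \sum_i (M * cnorm (x i)) * (eta * (cnorm (y i) * cnorm a)).
  rewrite -mulrA [M * _]mulrC -mulrA mulr_suml; apply: eq_bigr => i _; ring.
apply: ler_sum => i _; apply: le_trans (opnormM _ _) _.
by apply: ler_pM; rewrite ?opnorm_ge0.
Qed.

Lemma newton_defect_bound a b : opnorm (defect (newton phi) a b) <=
  (2 * K1 + (M * K1) ^+ 2) * eta ^+ 2 * (cnorm a * cnorm b).
Proof.
rewrite newton_defect //; apply: le_trans (opnormB _ _) _.
have -> : (2 * K1 + (M * K1) ^+ 2) * eta ^+ 2 * (cnorm a * cnorm b) =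
   (\sum_i (eta * (cnorm a * cnorm (x i))) * (eta * (cnorm (y i) * cnorm b)) +
    (\sum_i eta * (cnorm (x i) * cnorm (y i))) * (eta * (cnorm a * cnorm b))) +
   (M * K1 * eta * cnorm a) * (M * K1 * eta * cnorm b).
  rewrite -[\sum_i eta * _]mulr_sumr -/K1.
  have -> : \sum_i (eta * (cnorm a * cnorm (x i))) * (eta * (cnorm (y i) * cnorm b))
     = K1 * (eta ^+ 2 * (cnorm a * cnorm b)).
    by rewrite mulr_suml; apply: eq_bigr => i _; ring.
  ring.
apply: lerD; last first.
  apply: le_trans (opnormM _ _) _.
  by apply: ler_pM; rewrite ?opnorm_ge0 ?newton_corr_bound.
apply: le_trans (opnormD _ _) _; apply: lerD.
  apply: le_trans (opnorm_sum _) _; apply: ler_sum => i _.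
  by apply: le_trans (opnormM _ _) _; apply: ler_pM; rewrite ?opnorm_ge0.
apply: le_trans (opnormM _ _) _; apply: ler_pM; rewrite ?opnorm_ge0 //.
by apply: le_trans (opnorm_sum _) _; apply: ler_sum.
Qed.
End StepBounds.

Definition newton_lim n (sigma : {linear E -> 'M[C]_n}) a :=
  mlim (fun k => newton_iter sigma k a).

Definition near_hom (M eta : R) n (sigma : {linear E -> 'M[C]_n}) :=
  [/\ sigma 1 = 1%:M, forall a, opnorm (sigma a) <= M * cnorm a &
    forall a b, opnorm (defect sigma a b) <= eta * (cnorm a * cnorm b)].

Section Convergence.
Variables (M eta : R).
Hypothesis M0 : 0 <= M.
Hypothesis eta0 : 0 <= eta.
Local Notation L := ((M + 1) * K1).
Hypothesis eta1 : (2 * K1 + L ^+ 2) * eta <= 2^-1.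
Hypothesis eta2 : 2 * L * eta <= 1.

(** Quadratic convergence is only used to halve the defect at every step, which
    [eta1] guarantees as long as the norm of the iterate is at most [M + 1];
    [eta2] keeps the sum of all corrections, a geometric series, at most 1. *)
Lemma newton_iter_bounds n (sigma : {linear E -> 'M[C]_n}) k : near_hom M eta sigma ->
  near_hom (M + 2 * L * eta * (1 - 2^-1 ^+ k)) (eta * 2^-1 ^+ k) (newton_iter sigma k).
Proof.
move=> [s1 sM sD]; elim: k => [|k [IH1 IHM IHD]].
  by rewrite expr0 subrr mulr0 addr0 mulr1.
set h := 2^-1 ^+ k in IHM IHD *; have h0 : 0 <= h by rewrite exprn_ge0 ?invr_ge0.
have h1 : h <= 1 by rewrite exprn_ile1 ?invr_ge0 // invf_le1 // ler1n.
have -> : 2^-1 ^+ k.+1 = 2^-1 * h :> R by rewrite exprS.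
have L0 : 0 <= L by rewrite mulr_ge0 ?casimir_norm_ge0 // addr_ge0.
have eh0 : 0 <= eta * h by rewrite mulr_ge0.
have IHM' a : opnorm (newton_iter sigma k a) <= (M + 1) * cnorm a.
  apply: le_trans (IHM a) _; rewrite ler_wpM2r ?cnorm_ge0 // lerD2l.
  apply: le_trans (ler_piMr _ _) eta2; last by rewrite gerBl.
  by rewrite mulr_ge0 // mulr_ge0.
split=> [|a|a b] /=; first exact: newton1.
  apply: le_trans (opnormD _ _) _.
  apply: le_trans (lerD (IHM a) (newton_corr_bound IHM' IHD a)) _.
  rewrite -mulrDl ler_wpM2r ?cnorm_ge0 // -addrA lerD2l.
  have -> : 2 * L * eta * (1 - 2^-1 * h) = 2 * L * eta * (1 - h) + L * (eta * h).
    by field.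
  exact: lexx.
apply: le_trans (newton_defect_bound IH1 IHM' IHD a b) _.
rewrite ler_wpM2r ?mulr_ge0 ?cnorm_ge0 //.
have -> : (2 * K1 + L ^+ 2) * (eta * h) ^+ 2 =
  ((2 * K1 + L ^+ 2) * eta) * (h * (eta * h)) by ring.
have -> : eta * (2^-1 * h) = 2^-1 * (1 * (eta * h)) by ring.
apply: ler_pM => //; rewrite ?mulr_ge0 //.
  by rewrite addr_ge0 ?sqr_ge0 ?mulr_ge0 ?casimir_norm_ge0.
by rewrite ler_wpM2r.
Qed.

Lemma newton_iter_near n (sigma : {linear E -> 'M[C]_n}) k : near_hom M eta sigma ->
  near_hom (M + 1) (eta * 2^-1 ^+ k) (newton_iter sigma k).
Proof.
move=> /(newton_iter_bounds k)[s1 sM sD]; split=> // a.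
apply: le_trans (sM a) _; rewrite ler_wpM2r ?cnorm_ge0 // lerD2l.
apply: le_trans (ler_piMr _ _) eta2; last by rewrite gerBl exprn_ge0 ?invr_ge0.
by rewrite !mulr_ge0 ?casimir_norm_ge0 ?addr_ge0.
Qed.

Lemma newton_limP n (sigma : {linear E -> 'M[C]_n}) : near_hom M eta sigma ->
  forall a, mrapid (fun k => newton_iter sigma k a) (newton_lim sigma a).
Proof.
move=> Hs a; apply: (@mrapid_ex _ _ _ (L * eta * cnorm a)) => k.
have [s1 sM sD] := newton_iter_near k Hs.
rewrite /= /newton addrAC subrr add0r.
apply: le_trans (newton_corr_bound sM sD a) _.
by rewrite le_eqVlt; apply/orP; left; apply/eqP; ring.
Qed.

Lemma newton_lim_linear n (sigma : {linear E -> 'M[C]_n}) : near_hom M eta sigma ->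
  linear (newton_lim sigma).
Proof.
move=> Hs c a b; apply: mlimE.
have := mrapidD (mrapidZ c (newton_limP Hs a)) (newton_limP Hs b).
by congr mrapid; apply: funext => k; rewrite linearP.
Qed.

Lemma newton_lim1 n (sigma : {linear E -> 'M[C]_n}) : near_hom M eta sigma ->
  newton_lim sigma 1 = 1%:M.
Proof.
move=> Hs; apply: mlimE; have := mrapid_cst (1%:M : 'M[C]_n).
by congr mrapid; apply: funext => k; case: (newton_iter_near k Hs).
Qed.

Lemma newton_lim_bound n (sigma : {linear E -> 'M[C]_n}) : near_hom M eta sigma ->
  forall a, opnorm (newton_lim sigma a) <= (M + 1) * cnorm a.
Proof.
move=> Hs a; apply: mrapid_opnorm (newton_limP Hs a) _.
  by rewrite mulr_ge0 ?cnorm_ge0 // addr_ge0.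
by move=> k; case: (newton_iter_near k Hs).
Qed.

Lemma newton_limM n (sigma : {linear E -> 'M[C]_n}) : near_hom M eta sigma ->
  forall a b, newton_lim sigma (a * b) = newton_lim sigma a *m newton_lim sigma b.
Proof.
move=> Hs a b; apply: (mrapid_unique (newton_limP Hs (a * b))).
have D0 : mrapid (fun k => defect (newton_iter sigma k) a b) 0.
  move=> i j; exists (eta * (cnorm a * cnorm b)) => k.
  have [_ _ sD] := newton_iter_near k Hs.
  rewrite [X in _ - X]mxE subr0; apply: le_trans (normc_le_opnorm _ _ _) _.
  by rewrite mulrAC; exact: sD.
have := mrapidD (mrapidM (newton_limP Hs a) (newton_limP Hs b)) D0.
rewrite addr0; congr mrapid; apply: funext => k.
by rewrite /defect addrC subrK.
Qed.

Lemma newton_lim_intertwine n n' (T : 'M[C]_(n', n)) (sigma : {linear E -> 'M[C]_n})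
    (sigma' : {linear E -> 'M[C]_n'}) :
  near_hom M eta sigma -> near_hom M eta sigma' ->
  (forall a, T *m sigma a = sigma' a *m T) ->
  forall a, T *m newton_lim sigma a = newton_lim sigma' a *m T.
Proof.
move=> Hs Hs' HT a.
have HTk k : forall a, T *m newton_iter sigma k a = newton_iter sigma' k a *m T.
  by elim: k => [|k IHk] //=; exact: newton_intertwine.
apply: (mrapid_unique (mrapidM (mrapid_cst T) (newton_limP Hs a))).
have := mrapidM (newton_limP Hs' a) (mrapid_cst T).
by congr mrapid; apply: funext => k; rewrite HTk.
Qed.

End Convergence.

(** A multiplicative map is a fixed point of the iteration. *)
Lemma newton_lim_hom n (sigma : {linear E -> 'M[C]_n}) :
  (forall a b, sigma (a * b) = sigma a *m sigma b) ->
  forall a, newton_lim sigma a = sigma a.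
Proof.
move=> sM a; apply: mlimE; have := mrapid_cst (sigma a); congr mrapid.
apply: funext => k; elim: k a => [|k IHk] //= a.
rewrite /newton -IHk /newton_corr big1 ?addr0 // => i _.
by rewrite /defect -!IHk sM subrr mulmx0.
Qed.
End Newton.

(** * Noncommutative polynomials near an amplification *)

Section NcPoly.
Variables (R : realType) (g : nat).
Local Notation C := R[i].

(** Expressions rather than elements of a free algebra: only their values at
    points matter. *)
Inductive ncpoly :=
  | NcConst of C
  | NcVar of 'I_g
  | NcAdd of ncpoly & ncpoly
  | NcMul of ncpoly & ncpoly.

Fixpoint nceval n (X : ncpt R g n) (p : ncpoly) : 'M[C]_n :=
  match p with
  | NcConst c => c%:M
  | NcVar i => X i
  | NcAdd p q => nceval X p + nceval X q
  | NcMul p q => nceval X p *m nceval X q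
  end.

Definition ncsum d (c : 'I_d -> C) (p : 'I_d -> ncpoly) : ncpoly :=
  \big[NcAdd/NcConst 0]_i NcMul (NcConst (c i)) (p i).

Lemma nceval_sum d (c : 'I_d -> C) p n (X : ncpt R g n) :
  nceval X (ncsum c p) = \sum_i c i *: nceval X (p i).
Proof.
rewrite (big_morph (nceval X) (id1 := 0) (op1 := +%R)) //=; last first.
  by rewrite raddf0.
by apply: eq_bigr => i _; rewrite mul_scalar_mx.
Qed.

Lemma nceval_intertwine n n' (T : 'M[C]_(n', n)) (X : ncpt R g n)
    (X' : ncpt R g n') :
  (forall i, T *m X i = X' i *m T) ->
  forall p, T *m nceval X p = nceval X' p *m T.
Proof.
move=> TX; elim=> [c|i|p IHp q IHq|p IHp q IHq] //=.
- by rewrite scalar_mxC.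
- by rewrite mulmxDl mulmxDr IHp IHq.
- by rewrite mulmxA IHp -mulmxA IHq mulmxA.
Qed.

Lemma ptdsum_inl m n (X : ncpt R g m) (X' : ncpt R g n) i :
  col_mx 1%:M 0 *m X i = ptdsum X X' i *m col_mx 1%:M 0.
Proof.
by rewrite /ptdsum mul_col_mx mul_block_col mul1mx mul0mx !mulmx1 !mulmx0 !addr0.
Qed.

Lemma ptdsum_inr m n (X : ncpt R g m) (X' : ncpt R g n) i :
  col_mx 0 1%:M *m X' i = ptdsum X X' i *m col_mx 0 1%:M.
Proof.
by rewrite /ptdsum mul_col_mx mul_block_col mul1mx mul0mx !mulmx1 !mulmx0 !add0r.
Qed.

(** Turns naturality with respect to the two coordinate inclusions into
    compatibility with direct sums. *)
Lemma intertwine_block m n (A : 'M[C]_(m + n)) (B : 'M[C]_m) (D : 'M[C]_n) :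
  col_mx 1%:M 0 *m B = A *m col_mx 1%:M 0 ->
  col_mx 0 1%:M *m D = A *m col_mx 0 1%:M -> A = block_mx B 0 0 D.
Proof.
rewrite -[A]submxK 2!mul_block_col 2!mul_col_mx !mul1mx !mul0mx !mulmx1 !mulmx0.
by rewrite !addr0 !add0r => /eq_col_mx[-> ->] /eq_col_mx[<- <-].
Qed.

Lemma nceval_dsum m n (X : ncpt R g m) (X' : ncpt R g n) p :
  nceval (ptdsum X X') p = block_mx (nceval X p) 0 0 (nceval X' p).
Proof.
apply: intertwine_block; apply: nceval_intertwine => i.
  exact: ptdsum_inl.
exact: ptdsum_inr.
Qed.

(** A polynomial commutes with direct sums, so its value at an amplification of
    [Y] is the amplification of its value at [Y]. *)
Lemma nceval_ampl s (Y : ncpt R g s) p q m :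
  nceval Y p = nceval Y q -> nceval (ptampl m Y) p = nceval (ptampl m Y) q.
Proof.
move=> pq; elim: m => [|m IHm]; first by apply/matrixP => -[].
apply: etrans (nceval_dsum Y (ptampl m Y) p) _; rewrite pq IHm.
exact: esym (nceval_dsum Y (ptampl m Y) q).
Qed.

Definition amp_dist s (Y : ncpt R g s) m (X : ncpt R g (m * s)) : R :=
  ptnorm (fun i => X i - ptampl m Y i).

(** The constant is independent of the level [m], because an amplification has
    norm at most that of the point amplified.  The two bounds are proved together as
    the estimate for a product uses both. *)
Lemma nceval_lipschitz s (Y : ncpt R g s) p : exists2 K : R, 0 <= K &
  forall m (X : ncpt R g (m * s)), amp_dist Y X <= 1 ->
    opnorm (nceval X p) <= K /\
    opnorm (nceval X p - nceval (ptampl m Y) p) <= K * amp_dist Y X.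
Proof.
have amp_dist_ge0 m (X : ncpt R g (m * s)) : 0 <= amp_dist Y X by exact: ptnorm_ge0.
have damp m : amp_dist Y (ptampl m Y) <= 1.
  by apply: ptnorm_le => // i; rewrite subrr opnorm0.
elim: p => [c|i|p [K K0 IHp] q [L L0 IHq]|p [K K0 IHp] q [L L0 IHq]].
- exists (Normc.normc c) => [|m X _]; first exact: normc_ge0.
  by rewrite subrr opnorm0 mulr_ge0 ?normc_ge0 //; split=> //; exact: opnorm_scalar.
- exists (1 + opnorm (Y i)) => [|m X dX]; first by rewrite addr_ge0 ?opnorm_ge0.
  have Xi : opnorm (X i - ptampl m Y i) <= amp_dist Y X.
    exact: (ptnorm_ge (fun i => X i - ptampl m Y i)).
  split=> /=.
    rewrite -[X i](subrK (ptampl m Y i)); apply: le_trans (opnormD _ _) _.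
    by apply: lerD; [exact: le_trans Xi dX|exact: opnorm_ptampl].
  apply: le_trans Xi _; rewrite mulrDl mul1r lerDl mulr_ge0 ?opnorm_ge0 //.
- exists (K + L) => [|m X dX]; first by rewrite addr_ge0.
  have [[p1 p2] [q1 q2]] := (IHp m X dX, IHq m X dX); split=> /=.
    by apply: le_trans (opnormD _ _) _; exact: lerD.
  rewrite opprD addrACA mulrDl; apply: le_trans (opnormD _ _) _; exact: lerD.
- exists (K * L + K * L) => [|m X dX]; first by rewrite addr_ge0 ?mulr_ge0.
  have [[p1 p2] [q1 q2]] := (IHp m X dX, IHq m X dX).
  have [p3 _] := IHp m _ (damp m); split=> /=.
    apply: le_trans (opnormM _ _) _.
    apply: (@le_trans _ _ (K * L)); last by rewrite lerDl mulr_ge0.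
    apply: ler_pM; [exact: opnorm_ge0|exact: opnorm_ge0|exact: p1|exact: q1].
  set P := nceval X p in p1 p2 *; set Q := nceval X q in q1 q2 *.
  set P' := nceval _ p in p2 p3 *; set Q' := nceval _ q in q2 *.
  have -> : P *m Q - P' *m Q' = (P - P') *m Q + P' *m (Q - Q').
    by rewrite mulmxBl mulmxBr addrA subrK.
  rewrite mulrDl; apply: le_trans (opnormD _ _) _; apply: lerD.
    apply: le_trans (opnormM _ _) _; rewrite mulrAC.
    apply: ler_pM; [exact: opnorm_ge0|exact: opnorm_ge0|exact: p2|exact: q1].
  apply: le_trans (opnormM _ _) _; rewrite -mulrA.
  apply: ler_pM; [exact: opnorm_ge0|exact: opnorm_ge0|exact: p3|exact: q2].
Qed.

Lemma nceval_bounded s (Y : ncpt R g s) p : exists K : R, 0 <= K /\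
  forall m (X : ncpt R g (m * s)), amp_dist Y X <= 1 -> opnorm (nceval X p) <= K.
Proof.
by have [K K0 KP] := nceval_lipschitz Y p; exists K; split=> // m X /KP[].
Qed.

Lemma nceval_small s (Y : ncpt R g s) p : nceval Y p = 0 ->
  exists2 K : R, 0 <= K & forall m (X : ncpt R g (m * s)), amp_dist Y X <= 1 ->
    opnorm (nceval X p) <= K * amp_dist Y X.
Proof.
move=> p0; have [K K0 KP] := nceval_lipschitz Y p; exists K => // m X /KP[_].
have -> : nceval (ptampl m Y) p = nceval (ptampl m Y) (NcConst 0).
  by apply: nceval_ampl; rewrite p0 /= raddf0.
by rewrite /= raddf0 subr0.
Qed.

Lemma pt_alg_nceval s (Y : ncpt R g s.+1) a :
  a \in pt_alg Y -> exists p, nceval Y p = a.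
Proof.
move: a; apply: pt_alg_ind => [c a b [p <-] [q <-]||i a [p <-]].
- by exists (NcAdd (NcMul (NcConst c) p) q); rewrite /= mul_scalar_mx.
- by exists (NcConst 1).
- by exists (NcMul (NcVar i) p).
Qed.

Lemma ptamplD s (Y : ncpt R g s) m m' (E : (m * s + m' * s = (m + m') * s)%N) i :
  castmx (E, E) (ptdsum (ptampl m Y) (ptampl m' Y) i) = ptampl (m + m') Y i.
Proof.
apply/matrixP => a b; rewrite castmxE /=.
have s0 : (0 < s)%N.
  by case: (posnP s) (leq_trans (ltn0Sn _) (ltn_ord a)) => // ->; rewrite muln0.
pose r (x : nat) : 'I_s := Ordinal (ltn_pmod x s0).
have left_lt (u : 'I_(m * s)) : (u %/ s < m)%N by rewrite ltn_divLR.
have right_div (u : nat) : ((m * s + u) %/ s = m + u %/ s)%N by rewrite divnMDl.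
have right_mod (u : nat) : ((m * s + u) %% s = u %% s)%N by rewrite modnMDl.
rewrite (@ptampl_entry _ _ s _ Y i a b (r a) (r b) (a %/ s) (b %/ s));
  try exact: divn_eq.
rewrite /ptdsum mxE; case: splitP => u /= Eu; rewrite mxE;
  case: splitP => v /= Ev.
- by apply: ptampl_entry; rewrite -?Eu -?Ev; exact: divn_eq.
- rewrite mxE Eu Ev right_div ltn_eqF //.
  by apply: leq_trans (left_lt u) (leq_addr _ _).
- rewrite mxE Eu Ev right_div eq_sym ltn_eqF //.
  by apply: leq_trans (left_lt v) (leq_addr _ _).
- rewrite [in RHS]Eu [in RHS]Ev !right_div eqn_add2l.
  apply: ptampl_entry; rewrite /= ?Eu ?Ev right_mod; exact: divn_eq.
Qed.

Lemma ncball_dsum s (Y : ncpt R g s) e : ncsetP (ncball Y e).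
Proof.
move=> n n' X X' [m [En [m0 Xe]]] [m' [En' [m'0 Xe']]]; subst n n'.
have E : (m * s + m' * s = (m + m') * s)%N by rewrite mulnDl.
exists (m + m')%N, E; split; first by rewrite addn_gt0 m0.
apply: ptnorm_lt => [|i]; first by apply: le_lt_trans Xe; exact: ptnorm_ge0.
rewrite -(ptamplD Y E).
have -> : castmx (E, E) (ptdsum X X' i) -
    castmx (E, E) (ptdsum (ptampl m Y) (ptampl m' Y) i) =
    castmx (E, E) (block_mx (X i - ptampl m Y i) 0 0 (X' i - ptampl m' Y i)).
  have -> : block_mx (X i - ptampl m Y i) 0 0 (X' i - ptampl m' Y i) =
     ptdsum X X' i - ptdsum (ptampl m Y) (ptampl m' Y) i.
    by rewrite /ptdsum opp_block_mx add_block_mx !subr0.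
  by apply/matrixP => a b; rewrite !(castmxE, mxE).
rewrite opnorm_cast; apply: (@le_lt_trans _ _ (Num.max
  (opnorm (X i - ptampl m Y i)) (opnorm (X' i - ptampl m' Y i)))).
  by apply: opnorm_block; rewrite le_max lexx ?orbT.
rewrite gt_max; apply/andP; split.
  apply: le_lt_trans Xe.
  by have :=
    ptnorm_ge (fun i => castmx (erefl, erefl) (X i) - ptampl m Y i) i;
  rewrite /= castmx_id.
apply: le_lt_trans Xe'.
by have :=
    ptnorm_ge (fun i => castmx (erefl, erefl) (X' i) - ptampl m' Y i) i;
  rewrite /= castmx_id.
Qed.

End NcPoly.

(** * Polynomial lifts of the algebra of a point *)

Section Lift.
Variables (R : realType) (g : nat) (E : falgType R[i]).
Local Notation C := R[i].
Local Notation d := (\dim {:E}).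
Local Notation b := (vbasis {:E}).
Variable q : 'I_d -> ncpoly R g.

(** For fixed [X] a linear map on the algebra, for fixed [a] a noncommutative
    polynomial in [X]. *)
Definition polylift n (X : ncpt R g n) (a : E) : 'M[C]_n :=
  \sum_i coord b i a *: nceval X (q i).

Fact polylift_linear n (X : ncpt R g n) : linear (polylift X).
Proof.
move=> c u v; rewrite /polylift scaler_sumr -big_split; apply: eq_bigr => i _ /=.
by rewrite linearP scalerDl scalerA.
Qed.
HB.instance Definition _ n (X : ncpt R g n) :=
  GRing.isLinear.Build C E 'M[C]_n _ (polylift X) (polylift_linear X).

Lemma polylift_basis n (X : ncpt R g n) (i : 'I_d) : polylift X b`_i = nceval X (q i).
Proof.
rewrite /polylift (bigD1 i) //= big1 => [|j ji].
  by rewrite coord_free ?(basis_free (vbasisP _)) // eqxx scale1r addr0.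
by rewrite coord_free ?(basis_free (vbasisP _)) // eq_sym (negPf ji) scale0r.
Qed.

Lemma polylift_intertwine n n' (T : 'M[C]_(n', n)) (X : ncpt R g n)
    (X' : ncpt R g n') :
  (forall i, T *m X i = X' i *m T) -> forall a, T *m polylift X a = polylift X' a *m T.
Proof.
move=> TX a; rewrite /polylift mulmx_sumr mulmx_suml; apply: eq_bigr => i _.
by rewrite -scalemxAr -scalemxAl (nceval_intertwine TX).
Qed.

Variables (s : nat) (Y : ncpt R g s).
Hypothesis polylift1 : forall n (X : ncpt R g n), polylift X 1 = 1%:M.
Hypothesis polyliftM : forall a a', polylift Y (a * a') = polylift Y a *m polylift Y a'.

(** The defect on two basis vectors is itself a noncommutative polynomial, and it
    vanishes at [Y]; [nceval_small] makes it small near the amplifications of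
    [Y], at all levels simultaneously. *)
Lemma polylift_near : exists2 M : R, 0 <= M & forall eta : R, 0 < eta ->
  exists2 e : R, 0 < e & forall n (X : ncpt R g n), ncball Y e X ->
    near_hom M eta (polylift X).
Proof.
have /boolp.choice[B BP] i := nceval_bounded Y (q i).
(* the defect on a pair of basis vectors, as a polynomial *)
pose def (ij : 'I_d * 'I_d) := NcAdd (ncsum (fun k => coord b k (b`_ij.1 * b`_ij.2)) q)
  (NcMul (NcConst _ (-1)) (NcMul (q ij.1) (q ij.2))).
have defE n (X : ncpt R g n) ij : nceval X (def ij) = defect (polylift X) b`_ij.1 b`_ij.2.
  by rewrite /= nceval_sum mul_scalar_mx scaleN1r /defect !polylift_basis.
have /boolp.choice[K KP] (ij : 'I_d * 'I_d) : exists K : R, 0 <= K /\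
    forall m (X : ncpt R g (m * s)), amp_dist Y X <= 1 ->
    opnorm (defect (polylift X) b`_ij.1 b`_ij.2) <= K * amp_dist Y X.
  have [|K K0 KP] := @nceval_small _ _ _ Y (def ij).
    by rewrite defE /defect polyliftM subrr.
  exists K; split; first exact: K0.
  by move=> m X dX; rewrite -defE; exact: KP.
have B0 i : 0 <= B i by case: (BP i).
have K0 ij : 0 <= K ij by case: (KP ij).
exists (\sum_i B i); first exact: sumr_ge0.
move=> eta eta0; pose k := \sum_ij K ij + 1.
have k0 : 0 < k by rewrite ltr_wpDl // sumr_ge0.
exists (Num.min 1 (eta / k)); first by rewrite lt_min ltr01 divr_gt0.
move=> n X [m [En [m0]]]; subst n; rewrite lt_min => /andP[X1 Xe].
have dX : amp_dist Y X = ptnorm (fun i => castmx (erefl, erefl) (X i) - ptampl m Y i).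
  by apply: eq_bigr => i _; rewrite castmx_id.
rewrite -dX in X1 Xe; have {}X1 := ltW X1.
split=> [|a|a a']; first exact: polylift1.
  have polyliftB (i : 'I_d) : opnorm (polylift X b`_i) <= \sum_i B i.
    rewrite polylift_basis; have [_ /(_ m X X1)/le_trans] := BP i; apply.
    by rewrite (bigD1 i) //= lerDl sumr_ge0.
  exact: (linear_opnorm (polylift_linear X) polyliftB).
have defB (i j : 'I_d) : opnorm (defect (polylift X) b`_i b`_j) <= eta.
  have [_ /(_ m X X1)/= /le_trans] := KP (i, j); apply.
  apply: (@le_trans _ _ (k * (eta / k))).
    apply: ler_pM => //; [exact: ptnorm_ge0| |exact: ltW].
    by rewrite /k (bigD1 (i, j)) //= -addrA lerDl addr_ge0 // sumr_ge0.
  by rewrite mulrC divfK // gt_eqF.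
have lin1 z : linear (fun a => defect (polylift X) a z).
  move=> c u v; rewrite /defect mulrDl -scalerAl !linearP /= mulmxDl -scalemxAl.
  by rewrite scalerDr scalerN opprD addrACA.
have lin2 z : linear (defect (polylift X) z).
  move=> c u v; rewrite /defect mulrDr -scalerAr !linearP /=.
  by rewrite scalerDr addrACA.
have -> : eta * (cnorm a * cnorm a') = eta * cnorm a' * cnorm a by ring.
apply: (linear_opnorm (lin1 a')) => i.
exact: (linear_opnorm (lin2 _)).
Qed.

End Lift.

(** * The embedding into germs *)

Section Embedding.
Local Open Scope quotient_scope.
Variables (R : realType) (g s : nat) (Y : ncpt R g s.+1).
Local Notation C := R[i].
Local Notation E := (subvs_of (pt_alg Y)).
Local Notation d := (\dim {:E}).
Local Notation b := (vbasis {:E}).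

(** Polynomials [p i] with values the basis at [Y] give a lift sending 1 to some
    [u] with [u(Y) = 1] only.  Adding to [p i] the multiple [lam i] of [1 - u],
    where [lam] is a linear form with value 1 at 1 (here the top left matrix
    entry), repairs this at every point and changes nothing at [Y]. *)
Lemma unital_lift : exists q : 'I_d -> ncpoly R g,
  (forall n (X : ncpt R g n), polylift q X (1 : E) = 1%:M) /\
  (forall a, polylift q Y a = val a).
Proof.
have vsum (a : E) : val a = \sum_i coord b i a *: val b`_i.
  by rewrite {1}(full_coord a) /= linear_sum; apply: eq_bigr => i _; rewrite linearZ.
have /boolp.choice[p pP] (i : 'I_d) : exists p, nceval Y p = val b`_i.
  by apply: pt_alg_nceval; exact: subvsP.
pose c i := coord b i (1 : E); pose u := ncsum c p.
pose lam (i : 'I_d) : C := (val b`_i : 'M_s.+1) 0 0.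
exists (fun i => NcAdd (p i) (NcMul (NcConst g (lam i))
  (NcAdd (NcConst g 1) (NcMul (NcConst g (-1)) u)))).
have clam : \sum_i c i * lam i = 1.
  transitivity ((val (1 : E) : 'M[C]_s.+1) 0 0); last by rewrite val1_pt mxE eqxx.
  by rewrite vsum summxE; apply: eq_bigr => i _; rewrite mxE.
have uY : nceval Y u = 1%:M.
  rewrite nceval_sum -[RHS](val1_pt Y) vsum;
  by apply: eq_bigr => i _; rewrite pP.
split=> [n X|a].
  rewrite /polylift /=; under eq_bigr do rewrite !mul_scalar_mx scalerDr scalerA.
  rewrite big_split /= -scaler_suml clam scale1r -/(c _) nceval_sum scaleN1r.
  by rewrite addrC subrK.
rewrite /polylift vsum; apply: eq_bigr => i _.
by rewrite /= uY !mul_scalar_mx scaleN1r subrr scaler0 addr0 pP.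
Qed.

Variables (d' : nat) (x y : 'I_d' -> E).
Hypothesis xy1 : \sum_i x i * y i = 1.
Hypothesis xyC : forall a, exists c : 'M[C]_d',
  (forall i, a * x i = \sum_j c j i *: x j) /\
  (forall j, y j * a = \sum_i c j i *: y i).
Variable q : 'I_d -> ncpoly R g.
Hypothesis qY : forall a, polylift q Y a = val a.
Variables M eta e : R.
Hypothesis M0 : 0 <= M.
Hypothesis eta0 : 0 <= eta.
Local Notation L := ((M + 1) * casimir_norm x y).
Hypothesis eta1 : (2 * casimir_norm x y + L ^+ 2) * eta <= 2^-1.
Hypothesis eta2 : 2 * L * eta <= 1.
Hypothesis e0 : 0 < e.
Hypothesis near : forall n (X : ncpt R g n),
  ncball Y e X -> near_hom M eta (polylift q X).

Local Notation U := (ncball Y e).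
Definition lifted_hom (a : E) : ncmap R g := fun n X => newton_lim x y (polylift q X) a.

Fact ball_nbhd : ncnbhd Y U.
Proof.
split; [|exact: ncball_dsum|exact: ncball_center].
apply: uopen_ball => n X UX; split; last exact: ncball_sub.
by case: UX => m [En [m0 _]]; rewrite En muln_gt0 m0.
Qed.

Fact lifted_hom_intertwine n n' (T : 'M[C]_(n', n)) (X : ncpt R g n) (X' : ncpt R g n') :
  U X -> U X' -> (forall i, T *m X i = X' i *m T) ->
  forall a, T *m lifted_hom a X = lifted_hom a X' *m T.
Proof.
move=> UX UX' TX; apply: (newton_lim_intertwine xy1 xyC M0 eta0 eta1 eta2).
- exact: near.
- exact: near.
- exact: polylift_intertwine.
Qed.

Fact lifted_hom_nc a : ncfun U (lifted_hom a).
Proof.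
split=> [m n X X' UX UX'|n X S uS UX UX'].
  have UXX' : U (ptdsum X X') by exact: ncball_dsum.
  apply: intertwine_block; apply: lifted_hom_intertwine => // i.
    exact: ptdsum_inl.
  exact: ptdsum_inr.
rewrite (lifted_hom_intertwine UX UX') ?mulmxK // => i.
by rewrite /ptconj mulmxKV.
Qed.

Fact lifted_hom_ua a : uanalytic U (lifted_hom a).
Proof.
move=> n X UX; have [r r0 rU] := ncball_sub UX; exists r; split=> //.
exists ((M + 1) * cnorm a) => m Z /rU/near Hn.
exact: (newton_lim_bound xy1 xyC M0 eta0 eta1 eta2 Hn).
Qed.

Definition lifted_rep a : uarep Y := UARep ball_nbhd (lifted_hom_nc a) (lifted_hom_ua a).
Definition germ a : Oua Y := \pi_(Oua Y) (lifted_rep a).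

Fact germ_linear : linear germ.
Proof.
move=> c a a'; rewrite /germ -[RHS]/(oadd (omul (oconst Y c) _) _) !piE.
apply/eqP/OuaP; apply: uarep_equiv_cap => n X UX _ /=.
rewrite mul_scalar_mx; exact: (newton_lim_linear xy1 xyC M0 eta0 eta1 eta2 (near UX)).
Qed.

Fact germ_monoid : monoid_morphism germ.
Proof.
split.
  rewrite /germ -[RHS]/(oconst Y 1) !piE.
  apply/eqP/OuaP; apply: uarep_equiv_cap => n X UX _ /=.
  exact: (newton_lim1 xy1 xyC M0 eta0 eta1 eta2 (near UX)).
move=> a a'; rewrite /germ -[RHS]/(omul _ _) !piE.
apply/eqP/OuaP; apply: uarep_equiv_cap => n X UX _ /=.
exact: (newton_limM xy1 xyC M0 eta0 eta1 eta2 (near UX)).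
Qed.

(** At [Y] itself the polynomial lift is already multiplicative. *)
Lemma lifted_hom_center a : lifted_hom a Y = val a.
Proof. rewrite /lifted_hom; apply: etrans (qY a); apply: newton_lim_hom => u v /=.
by rewrite !qY. Qed.

Lemma germ_inj : injective germ.
Proof.
move=> a a' /eqP/OuaP[W [[_ _ WY] _ _ /(_ _ _ WY)]] /=.
by rewrite !lifted_hom_center => /val_inj.
Qed.

End Embedding.

Theorem semisimple_embedding (R : realType) (g s : nat) (Y : ncpt R g s.+1) :
  semisimple_pt Y ->
  exists phi : {lrmorphism subvs_of (pt_alg Y) -> Oua Y}, injective phi.
Proof.
move=> Yss; have [x [y [xy1 xyC]]] := separability_idempotent (pt_regtr_nondeg Yss).
have [q [q1 qY]] := unital_lift Y.
have qM a a' : polylift q Y (a * a') = polylift q Y a *m polylift q Y a' by rewrite !qY.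
have [M M0 nearM] := polylift_near q1 qM.
pose L := (M + 1) * casimir_norm x y.
have K0 := casimir_norm_ge0 x y.
have L0 : 0 <= L by rewrite mulr_ge0 // addr_ge0.
pose A := 2 * casimir_norm x y + L ^+ 2.
have A0 : 0 <= A by rewrite addr_ge0 ?sqr_ge0 ?mulr_ge0.
(* small enough for both smallness conditions of the iteration *)
pose eta := (2 * (A + 2 * L + 1))^-1.
have den0 : 0 < 2 * (A + 2 * L + 1) by lra.
have eta0 : 0 < eta by rewrite invr_gt0.
have eta1 : A * eta <= 2^-1.
  by rewrite /eta ler_pdivrMr //; lra.
have eta2 : 2 * L * eta <= 1.
  by rewrite /eta ler_pdivrMr //; lra.
have [e e0 near] := nearM eta eta0.
pose h := germ xy1 xyC M0 (ltW eta0) eta1 eta2 e0 near.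
pose hlin := GRing.isLinear.Build R[i] _ _ _ h
  (germ_linear xy1 xyC M0 (ltW eta0) eta1 eta2 e0 near).
pose hmon := GRing.isMonoidMorphism.Build _ _ h
  (germ_monoid xy1 xyC M0 (ltW eta0) eta1 eta2 e0 near).
pose phi : {lrmorphism subvs_of (pt_alg Y) -> Oua Y} := HB.pack h hlin hmon.
by exists phi; exact: germ_inj.
Qed.

(** * The theorem *)

(** The components of [Y] are diagonalizable and commute, so they are
    simultaneously diagonalizable. *)
Lemma scalar_dsum_similar (R : realType) (g s : nat) (Y : ncpt R g s.+1) :
  (forall a, a \in pt_alg Y -> a * a = 0 -> a = 0) ->
  exists lam : 'I_s.+1 -> 'I_g -> R[i], pt_similar Y (scalar_dsum lam).
Proof.
move=> Ared; have AM a b : a \in pt_alg Y -> b \in pt_alg Y -> a * b \in pt_alg Y.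
  exact: pt_alg_mul.
have Ap a p : a \in pt_alg Y -> horner_mx a p \in pt_alg Y.
  exact: pt_alg_horner.
have /codiagonalizableP[P Pu /allP PY] :
    {in codom Y &, forall A B, comm_mx A B} /\
    {in codom Y, forall A, diagonalizable A}.
  split=> [A B /codomP[i ->] /codomP[j ->]|A /codomP[i ->]].
    exact: (reduced_comm AM Ap Ared (pt_alg_gen Y i) (pt_alg_gen Y j)).
  exact: (reduced_diagonalizable AM Ap Ared (pt_alg_gen Y i)).
have /boolp.choice[D DP] i : exists D, Y i ~_P (diag_mx D).
  by apply/diagonalizable_forPex/PY/codom_f.
exists (fun j i => D i 0 j), P => //; apply: funext => i.
rewrite /scalar_dsum /ptconj -(simmxRL Pu (DP i)); congr diag_mx.
by apply/rowP => j; rewrite mxE.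
Qed.

Theorem theorem3 (R : realType) (g s : nat) (Y : ncpt R g s.+1)
    (Yss : semisimple_pt Y) :
  [/\ exists phi : {lrmorphism subvs_of (pt_alg Y) -> Oua Y}, injective phi,
      pt_alg Y = fullv :> {vspace 'M[R[i]]_s.+1} ->
        exists (A : algType R[i]) (phi : {rmorphism Oua Y -> 'M[A]_s.+1}),
          bijective phi /\
          forall (c : R[i]) (f : Oua Y),
            phi (c *: f) = map_mx (fun a : A => c *: a) (phi f)
    & ~ (exists lam : 'I_s.+1 -> 'I_g -> R[i], pt_similar Y (scalar_dsum lam)) ->
        exists f : Oua Y, f != 0 /\ f ^+ 2 = 0].
Proof.
have [phi phi_inj] := semisimple_embedding Yss; split; first by exists phi.
  move=> Yfull; pose u i j : subvs_of (pt_alg Y) := vsproj (pt_alg Y) (delta_mx i j).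
  have uE i j : val (u i j) = delta_mx i j by rewrite /= vsprojK // Yfull memvf.
  apply: (@matrix_units_iso _ _ _ (fun i j => phi (u i j))) => [i j k l|].
    rewrite -rmorphM; have [<-|jk] := eqVneq j k.
      by congr (phi _); apply: val_inj; rewrite valM_pt !uE; exact: mul_delta_mx.
    rewrite -[RHS](rmorph0 phi); congr (phi _); apply: val_inj.
    by rewrite valM_pt !uE; exact: mul_delta_mx_0.
  rewrite -rmorph_sum -[RHS](rmorph1 phi); congr (phi _); apply: val_inj.
  rewrite val1_pt; transitivity (1%:M : 'M[R[i]]_s.+1); last by [].
  rewrite mx1_sum_delta /= linear_sum; apply: eq_bigr => i _; exact: uE.
move=> Ysim; apply: contrapT => Ono; apply: Ysim; apply: scalar_dsum_similar.
move=> a Aa aa; apply: contrapT => /eqP a0; apply: Ono.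
exists (phi (vsproj (pt_alg Y) a)); split.
  rewrite -[0](rmorph0 phi) (inj_eq phi_inj); apply: contra_neq a0 => a0.
  by rewrite -(vsprojK Aa) a0.
rewrite expr2 -rmorphM -[RHS](rmorph0 phi); congr (phi _); apply: val_inj.
by rewrite valM_pt /= vsprojK.
Qed.
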